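(* Let $G$ be a graph on $[n]$ which is strongly upper crossed with respect to a total order $\unlhd$ on $E(G)$. Then, with NBC sets taken with respect to $\unlhd$: (a) $NC_G$ is graded with rank function $\rho(X)=n-cc(X)$; (b) the minimum labeling with respect to $\unlhd$ is an EL-labeling of $NC_G$, so $NC_G$ is shellable; (c) for every $X\in NC_G$, the labels along any decreasing saturated chain from $\hat0$ to $X$ form a spanning noncrossing NBC set of $X$; (d) for every $X\in NC_G$, each spanning noncrossing NBC set of $X$ appears exactly once as the label set of a decreasing saturated chain from $\hat0$ to $X$; (e) for $H\in NC_G$, $\mu(H)=(-1)^{n-cc(H)}\mathrm{ncnbc}_{n-cc(H)}(H)$, and $\chi(NC_G,t)=\sum_{k\ge0}(-1)^k\mathrm{ncnbc}_k(G)\,t^{\rho(NC_G)-k}$.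
   Context: Graphs are finite simple graphs with vertex set $[n]$; edges are written $ij$ with $i<j$. Two edges $a_1a_2$ and $b_1b_2$ cross if $a_1<b_1<a_2<b_2$ or $b_1<a_1<b_2<a_2$. $G$ is strongly upper crossed with respect to $\unlhd$ if for every pair of crossing edges $e,f$ there is at least one induced connected subgraph of $G$ containing $e$ and $f$ that is minimal (under containment) with this property, and every edge of every such minimal induced connected subgraph, other than $e$ and $f$, precedes both $e$ and $f$ in $\unlhd$. A spanning subgraph is identified with its edge set; $cc(X)$ is its number of connected components. A bond of $G$ is a spanning subgraph each of whose components is an induced subgraph of $G$; it is noncrossing if there are no two distinct components with vertex sets $B,B'$ and $a,c\in B$, $b,d\in B'$, $a<b<c<d$. $NC_G$ is the poset of noncrossing bonds ordered by inclusion of edge sets, with minimum $\hat0$ the empty bond. The minimum labeling assigns to a cover $H\lessdot H'$ the label $\min_{\unlhd}(E(H')\setminus E(H))$. EL-labeling: every interval has a unique maximal chain with strictly increasing labels, lexicographically preceding all other maximal chains of the interval; decreasing chains have strictly decreasing labels; shellable means the order complex is shellable. A broken circuit is a cycle's edge set minus its $\unlhd$-smallest edge; an NBC set contains no broken circuit; a noncrossing NBC set is an NBC set with no two crossing edges; a spanning noncrossing NBC set of $X\in NC_G$ is a noncrossing NBC set $S\subseteq E(X)$ whose spanning subgraph has the same connected-component vertex sets as $X$; $\mathrm{ncnbc}_k(X)$ is the number of noncrossing NBC sets of $X$ of size $k$. Möbius function: $\mu(\hat0)=1$, $\mu(x)=-\sum_{y<x}\mu(y)$; $\chi(P,t)=\sum_{x}\mu(x)t^{\rho(P)-\rho(x)}$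 with $\rho(P)$ the rank of $P$. *)

(* Defs.v *)
From HB Require Import structures.
From mathcomp Require Import all_boot all_order all_algebra.
Set Implicit Arguments. Unset Strict Implicit. Unset Printing Implicit Defensive.
Import GRing.Theory Num.Theory.

(* Vertex set [n] is represented by 'I_n (ordered by nat value);
   an edge ij with i<j is the pair (i,j). *)
Definition edge (n : nat) := ('I_n * 'I_n)%type.

Definition simple_graph n (E : {set edge n}) : Prop :=
  forall e, e \in E -> (e.1 < e.2)%N.

Definition crossing n (e f : edge n) : bool :=
  [&& (e.1 < f.1)%N, (f.1 < e.2)%N & (e.2 < f.2)%N]
  || [&& (f.1 < e.1)%N, (e.1 < f.2)%N & (f.2 < e.2)%N].

Definition total_order_on n (E : {set edge n}) (le : rel (edge n)) : Prop :=
  [/\ {in E, forall x, le x x},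
      {in E &, forall x y, le x y -> le y x -> x = y},
      (forall x y z, x \in E -> y \in E -> z \in E -> le x y -> le y z -> le x z) &
      {in E &, forall x y, le x y || le y x}].

Definition lt_of n (le : rel (edge n)) : rel (edge n) :=
  fun e f => le e f && (e != f).

Definition adj n (X : {set edge n}) : rel 'I_n :=
  fun u v => ((u, v) \in X) || ((v, u) \in X).

Definition induced n (E : {set edge n}) (S : {set 'I_n}) : {set edge n} :=
  [set e in E | (e.1 \in S) && (e.2 \in S)].

Definition conn_ind_containing n (E : {set edge n}) (e f : edge n) (S : {set 'I_n}) : bool :=
  [&& e.1 \in S, e.2 \in S, f.1 \in S, f.2 \in S &
      [forall u in S, forall v in S, connect (adj (induced E S)) u v]].

Definition minimal_cic n (E : {set edge n}) (e f : edge n) (S : {set 'I_n}) : bool :=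
  conn_ind_containing E e f S &&
  [forall S' : {set 'I_n}, (S' \proper S) ==> ~~ conn_ind_containing E e f S'].

Definition strongly_upper_crossed n (E : {set edge n}) (le : rel (edge n)) : Prop :=
  forall e f, e \in E -> f \in E -> crossing e f ->
    (exists S, minimal_cic E e f S) /\
    (forall S, minimal_cic E e f S ->
       forall g, g \in induced E S -> g != e -> g != f ->
         lt_of le g e && lt_of le g f).

Definition comp n (X : {set edge n}) (x : 'I_n) : {set 'I_n} :=
  [set y | connect (adj X) x y].
Definition cc n (X : {set edge n}) : nat := #|[set comp X x | x : 'I_n]|.
Definition rk n (X : {set edge n}) : nat := (n - cc X)%N.

(* bond: each component is an induced subgraph of G *)
Definition is_bond n (E X : {set edge n}) : bool :=
  (X \subset E) && [forall e in E, connect (adj X) e.1 e.2 ==> (e \in X)].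

Definition noncrossing_bond n (X : {set edge n}) : bool :=
  [forall a : 'I_n, forall b : 'I_n, forall c : 'I_n, forall d : 'I_n,
     [&& (a < b)%N, (b < c)%N, (c < d)%N, connect (adj X) a c & connect (adj X) b d]
     ==> connect (adj X) a b].

Definition isNC n (E X : {set edge n}) : bool := is_bond E X && noncrossing_bond X.

Definition covers n (E : {set edge n}) : rel {set edge n} :=
  fun X Y => [&& isNC E X, isNC E Y, X \proper Y &
               [forall Z : {set edge n}, ~~ [&& isNC E Z, X \proper Z & Z \proper Y]]].

Definition sat_chain n (E : {set edge n}) (X Y : {set edge n}) (s : seq {set edge n}) : bool :=
  path (covers E) X s && (last X s == Y).

Definition mlab n (le : rel (edge n)) (X Y : {set edge n}) : option (edge n) :=
  [pick e in Y :\: X | [forall f in Y :\: X, le e f]].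

Definition labels n (le : rel (edge n)) (X : {set edge n}) (s : seq {set edge n}) :=
  pairmap (mlab le) X s.

Definition labelset n (l : seq (option (edge n))) : {set edge n} :=
  [set e | Some e \in l].

Definition lt_lab n (le : rel (edge n)) : rel (option (edge n)) :=
  fun a b => match a, b with Some x, Some y => lt_of le x y | _, _ => false end.

Definition increasing n (le : rel (edge n)) (l : seq (option (edge n))) : bool :=
  sorted (lt_lab le) l.
Definition decreasing n (le : rel (edge n)) (l : seq (option (edge n))) : bool :=
  sorted (fun a b => lt_lab le b a) l.

Definition lex_lt (T : Type) (r : rel T) (x0 : T) (s t : seq T) : Prop :=
  exists i, [/\ (i < size t)%N, take i s = take i t &
                (i = size s \/ ((i < size s)%N /\ r (nth x0 s i) (nth x0 t i)))].

Definition EL_labeling n (E : {set edge n}) (le : rel (edge n)) : Prop :=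
  forall X Y, isNC E X -> isNC E Y -> X \subset Y ->
    exists s, [/\ sat_chain E X Y s, increasing le (labels le X s) &
      forall s', sat_chain E X Y s' -> s' <> s ->
        ~~ increasing le (labels le X s') /\
        lex_lt (lt_lab le) None (labels le X s) (labels le X s')].

Definition is_facet (T : finType) (face : pred {set T}) (F : {set T}) : bool :=
  face F && [forall F' : {set T}, (face F' && (F \subset F')) ==> (F' == F)].

Definition shellable (T : finType) (face : pred {set T}) : Prop :=
  exists s : seq {set T},
    [/\ uniq s, (forall F, (F \in s) = is_facet face F) &
        forall i j, (i < j < size s)%N ->
          exists2 k, (k < j)%N &
            exists2 x, x \in nth set0 s j &
              (nth set0 s k :&: nth set0 s j = nth set0 s j :\ x) /\
              (nth set0 s i :&: nth set0 s j \subset nth set0 s j :\ x)].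

Definition order_complex n (E : {set edge n}) : pred {set {set edge n}} :=
  fun F => [forall X in F, isNC E X] &&
           [forall X in F, forall Y in F, (X \subset Y) || (Y \subset X)].

Definition mkedge n (u v : 'I_n) : edge n := if (u < v)%N then (u, v) else (v, u).

Definition cycle_edges n (vs : seq 'I_n) : {set edge n} :=
  [set mkedge p.1 p.2 | p in zip vs (rot 1 vs)].

Definition is_cycle n (E C : {set edge n}) : bool :=
  [exists k : 'I_n.+1, exists t : (k : nat).-tuple 'I_n,
     [&& uniq t, (2 < k)%N, C == cycle_edges t & C \subset E]].

Definition nbc n (E : {set edge n}) (le : rel (edge n)) (S : {set edge n}) : bool :=
  [forall C, is_cycle E C ==>
     [forall e in C, [forall f in C, le e f] ==> ~~ (C :\ e \subset S)]].

Definition noncrossing_set n (S : {set edge n}) : bool :=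
  [forall e in S, forall f in S, ~~ crossing e f].

Definition ncnbc_set n (E : {set edge n}) (le : rel (edge n)) (X S : {set edge n}) : bool :=
  [&& S \subset X, nbc E le S & noncrossing_set S].

Definition ncnbc n (E : {set edge n}) (le : rel (edge n)) (k : nat) (X : {set edge n}) : nat :=
  #|[set S | ncnbc_set E le X S && (#|S| == k)]|.

Definition spanning_ncnbc n (E : {set edge n}) (le : rel (edge n)) (X S : {set edge n}) : bool :=
  ncnbc_set E le X S && [forall x, comp S x == comp X x].

Fixpoint mob_aux n (E : {set edge n}) (fuel : nat) (X : {set edge n}) : int :=
  match fuel with
  | 0 => 1%R
  | f.+1 => if X == set0 then 1%R
            else (- \sum_(Y : {set edge n} | isNC E Y && (Y \proper X)) mob_aux E f Y)%R
  end.
Definition mobius n (E X : {set edge n}) : int := mob_aux E #|X| X.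

Definition rhoP n (E : {set edge n}) : nat := \max_(X : {set edge n} | isNC E X) rk X.

Definition chi_at n (E : {set edge n}) (R : nzRingType) (t : R) : R :=
  (\sum_(X : {set edge n} | isNC E X) (mobius E X)%:~R * t ^+ (rhoP E - rk X))%R.

(* Main.v *)
Require Import Defs.
From HB Require Import structures.
From mathcomp Require Import all_boot all_order all_algebra.
From mathcomp Require Import zify.
Import Order.Theory GRing.Theory Num.Theory.
Set Implicit Arguments.
Unset Strict Implicit.
Unset Printing Implicit Defensive.

(** If X is properly below Y in NC_G and m is the least edge of Y \ X, then
    merging the two blocks of X joined by m gives again a noncrossing bond: an
    edge f of X crossing m lies with m in a block of Y, and all other edges of a
    minimal connected induced subgraph of that block containing m and f precede
    m, hence belong to X and already tie f to m.  So covers are exactly such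
    merges, a label determines its cover, and the greedy chain is the increasing
    one.

    If m is the least edge of a noncrossing bond X, then no edge of X crosses m,
    and adding m to a noncrossing NBC set of X yields another one.  Labels of
    decreasing chains are the successive least edges, which gives (c) and (d);
    toggling m is the sign-reversing involution behind (e), once NBC sets are
    sorted by the noncrossing bond they span.

    For shellability, facets have exactly one element per rank and are ordered
    lexicographically by labels.  If two facets part at rank d and the earlier one
    adds m there, the later one picks m up only after a strict descent, and
    exchanging the element at the descent for the greedy one moves it earlier. *)

Local Notation comp := Defs.comp.
Local Notation con X := (connect (adj X)).

(** * Walks and reachability *)

Section Connectivity.
Variable T : finType.
Implicit Types r : rel T.

Lemma connect_ind r (P : T -> Prop) x :
  P x -> (forall u v, connect r x u -> r u v -> P u -> P v) ->
  forall y, connect r x y -> P y.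
Proof.
move=> Px Pstep y /connectP[p]; elim/last_ind: p y => [|p z IH] y.
  by move=> _ ->.
rewrite rcons_path last_rcons => /andP[rp rz] ->.
apply: Pstep rz (IH _ rp erefl).
by apply/connectP; exists p.
Qed.

Lemma connect_exit r (P : pred T) x y : connect r x y -> P x -> ~~ P y ->
  exists u v, [/\ connect r x u, r u v, P u & ~~ P v].
Proof.
move=> /connectP[p]; elim: p x => [|z p IH] x /= => [_ -> -> //|].
case/andP=> rxz rp yE Px NPy.
have [Pz|NPz] := boolP (P z); last by exists x, z.
have [u [v [zu uv Pu NPv]]] := IH _ rp yE Pz NPy.
exists u, v; split=> //; exact: connect_trans (connect1 rxz) zu.
Qed.

End Connectivity.

(** * Connected components and rank of an edge set *)

Section Graph.
Variable n : nat.
Implicit Types (E X Y S : {set edge n}) (e f m : edge n) (x y u v : 'I_n).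

Lemma adj_sym X : symmetric (adj X).
Proof. by move=> x y; rewrite /adj orbC. Qed.

Lemma con_sym X : symmetric (con X).
Proof. exact/sym_connect_sym/adj_sym. Qed.

Lemma con_edge X e : e \in X -> con X e.1 e.2.
Proof. by case: e => a b /= eX; apply: connect1; rewrite /adj eX. Qed.

Lemma con_adj X x y : adj X x y ->
  exists2 e, e \in X & (e = (x, y)) \/ (e = (y, x)).
Proof. by case/orP=> h; [exists (x, y) | exists (y, x)]; auto. Qed.

Lemma con_sub X Y x y :
  (forall e, e \in X -> con Y e.1 e.2) -> con X x y -> con Y x y.
Proof.
move=> sXY; apply: (connect_ind (P := fun y => con Y x y)) => //.
move=> u v _ /con_adj[e eX uvE] xu; apply: connect_trans xu _.
by have := sXY _ eX; case: uvE => -> //=; rewrite con_sym.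
Qed.

Lemma conS X Y x y : X \subset Y -> con X x y -> con Y x y.
Proof. by move=> /subsetP sXY; apply: con_sub => e /sXY/con_edge. Qed.

Lemma con0 x y : con (set0 : {set edge n}) x y -> x = y.
Proof.
apply: (connect_ind (P := fun y => x = y)) => // u v _.
by rewrite /adj !inE.
Qed.

(** The right-hand side is stable under appending an edge to a walk: going through [m] a second time
    falls back to a disjunct with at most one passage. *)
Lemma conU1 X m x y :
  con (m |: X) x y =
  [|| con X x y, con X x m.1 && con X m.2 y | con X x m.2 && con X m.1 y].
Proof.
apply/idP/idP => [|/or3P[|/andP[]|/andP[]]]; last first.
- move=> xm my; apply: connect_trans (conS (subsetUr _ _) xm) _.
  apply: connect_trans (conS (subsetUr _ _) my).
  by rewrite con_sym con_edge // setU11.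
- move=> xm my; apply: connect_trans (conS (subsetUr _ _) xm) _.
  apply: connect_trans (conS (subsetUr _ _) my).
  by rewrite con_edge // setU11.
- by apply: conS; apply: subsetUr.
apply: (connect_ind (P := fun y => [|| con X x y,
  con X x m.1 && con X m.2 y | con X x m.2 && con X m.1 y])).
  by rewrite connect0.
move=> u v _ /con_adj[e] /setU1P[->|eX] uvE.
  case: uvE => -> /=; case/or3P=> [|/andP[]|/andP[]].
  - by move=> ->; rewrite connect0 orbT.
  - by move=> -> _; rewrite connect0 orbT.
  - by move=> ->.
  - by move=> ->; rewrite connect0 !orbT.
  - by move=> ->.
  - by move=> -> _; rewrite connect0 !orbT.
have uv : con X u v.
  by have := con_edge eX; case: uvE => -> //=; rewrite con_sym.
case/or3P=> [xu|/andP[-> mu]|/andP[-> mu]].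
- by rewrite (connect_trans xu uv).
- by rewrite (connect_trans mu uv) orbT.
- by rewrite (connect_trans mu uv) !orbT.
Qed.

Lemma in_comp X x y : (y \in comp X x) = con X x y.
Proof. by rewrite inE. Qed.

Lemma eq_comp X x y : (comp X x == comp X y) = con X x y.
Proof.
apply/eqP/idP => [|xy].
  by move/setP/(_ y); rewrite !in_comp connect0.
apply/setP => z; rewrite !in_comp.
exact: (same_connect (@con_sym X)).
Qed.

Lemma comp_con X Y : (forall x, comp X x = comp Y x) <-> con X =2 con Y.
Proof.
split=> h x => [y|]; first by rewrite -!in_comp h.
by apply/setP => y; rewrite !in_comp h.
Qed.

Lemma eq_cc X Y : con X =2 con Y -> cc X = cc Y.
Proof.
by move=> /comp_con h; rewrite /cc; congr #|pred_of_set _|; apply: eq_imset.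
Qed.

Lemma cc_leq X : cc X <= n.
Proof. by rewrite -{2}(card_ord n); exact: leq_imset_card. Qed.

Lemma cc0 : cc (set0 : {set edge n}) = n.
Proof.
rewrite /cc card_imset ?card_ord // => x y /eqP.
by rewrite eq_comp; apply: con0.
Qed.

Lemma rk0 : rk (set0 : {set edge n}) = 0.
Proof. by rewrite /rk cc0 subnn. Qed.

Lemma leq_cc X Y : X \subset Y -> cc Y <= cc X.
Proof.
(* [F] sends a vertex set to the union of the components of [Y] that meet it, and so maps the
   components of [X] onto those of [Y]. *)
move=> sXY; pose F (A : {set 'I_n}) := \bigcup_(y in A) comp Y y.
have FE x : F (comp X x) = comp Y x.
  apply/setP => z; apply/bigcupP/idP => [[y]|xz].
    by rewrite !in_comp => /(conS sXY); apply: connect_trans.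
  by rewrite in_comp in xz; exists x; rewrite ?in_comp ?connect0.
apply: leq_trans (leq_imset_card F [set comp X x | x : 'I_n]).
apply/subset_leq_card/subsetP => _ /imsetP[x _ ->].
by rewrite -FE; apply/imset_f/imset_f.
Qed.

(** The components [A] and [B] of the two ends of [m] are distinct; adding [m] replaces them by
    their union and leaves the others alone. *)
Lemma ccU1 X m : ~~ con X m.1 m.2 -> cc X = (cc (m |: X)).+1.
Proof.
move=> Nm; pose A := comp X m.1; pose B := comp X m.2.
set K := [set comp X x | x : 'I_n].
have AK : A \in K by apply: imset_f.
have AB : A != B by rewrite eq_comp.
have BK : B \in K :\ A by rewrite !inE eq_sym AB; apply: imset_f.
have compE x : comp (m |: X) x =
    if (x \in A) || (x \in B) then A :|: B else comp X x.
  apply/setP => y; have sX := @con_sym X.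
  case: ifP; rewrite !inE conU1 ![con X _ x]sX.
    case/orP=> xm; rewrite -(same_connect sX xm) xm /=.
      have ->: con X x m.2 = false.
        by apply: contraNF Nm; apply: connect_trans; rewrite sX.
      by rewrite orbF.
    have ->: con X x m.1 = false.
      by apply: contraNF Nm; rewrite sX => xm1; rewrite (connect_trans _ xm) // sX.
    by rewrite /= orbC.
  by move=> /norP[/negbTE-> /negbTE->]; rewrite !orbF.
rewrite {2}/cc; have -> : [set comp (m |: X) x | x : 'I_n] = (A :|: B) |: (K :\ A :\ B).
  apply/setP => C; rewrite !inE; apply/imsetP/idP => [[x _ ->]|].
    rewrite compE; case: ifP => [_|]; first by rewrite eqxx.
    rewrite !in_comp => /norP[xA xB]; rewrite !eq_comp ![con X x _]con_sym xA xB.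
    by rewrite imset_f ?orbT.
  case/orP=> [/eqP->|/and3P[CB CA /imsetP[x _ CE]]].
    by exists m.1; rewrite // compE in_comp connect0.
  exists x => //; rewrite compE ifF ?CE //; apply/negbTE.
  by rewrite !in_comp -!eq_comp -!CE negb_or ![comp X _ == C]eq_sym CA CB.
have ABK : A :|: B \notin K :\ A :\ B.
  apply/negP; rewrite !inE => /and3P[_ NA /imsetP[x _ CE]].
  have : m.1 \in comp X x by rewrite -CE inE in_comp connect0.
  by rewrite in_comp -eq_comp -CE (negbTE NA).
rewrite /cc -/K cardsU1 ABK (cardsD1 A K) AK.
by rewrite (cardsD1 B (K :\ A)) BK.
Qed.

(** * Crossing edges, crossing components and closure *)

Lemma crossingC e f : crossing e f = crossing f e.
Proof. by rewrite /crossing orbC. Qed.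

(* Discrete Jordan argument: the interval spanned by [f] is left by any walk
   from a vertex inside it to a vertex outside, and since the walk avoids the
   ends of [f], some edge of the walk crosses [f]. *)
Lemma crossing_of_exit X f x y : simple_graph X -> f \in X ->
  con X x y -> ~~ con X x f.1 -> f.1 < x < f.2 -> ~~ (f.1 < y < f.2) ->
  exists e, [/\ e \in X, crossing e f & con X x e.1].
Proof.
move=> sX fX xy Nxf xin yout.
have [u [v [xu uv uin vout]]] :=
  connect_exit (P := fun z : 'I_n => f.1 < z < f.2) xy xin yout.
have xv := connect_trans xu (connect1 uv).
have Nv1 : v != f.1 by apply: contraNneq Nxf => <-.
have Nv2 : v != f.2.
  by apply: contraNneq Nxf => vE; rewrite (connect_trans xv) // vE con_sym con_edge.
have {}Nv1 : (v : nat) <> f.1 by move=> h; case/eqP: Nv1; apply: val_inj.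
have {}Nv2 : (v : nat) <> f.2 by move=> h; case/eqP: Nv2; apply: val_inj.
have [e eX uvE] := con_adj uv; exists e; split=> //.
  have := sX _ eX; have := sX _ fX; rewrite /crossing.
  by case: uvE => -> /=; clear -uin vout Nv1 Nv2; lia.
by case: uvE => -> /=.
Qed.

(** The walk from [b] to [d] leaves the interval between [a] and [c] along some edge [f]. Exactly
    one of [a] and [c] then lies between the ends of [f], so the walk joining them has an edge that
    crosses [f]. *)
Lemma crossing_components X (a b c d : 'I_n) : simple_graph X ->
  a < b -> b < c -> c < d -> con X a c -> con X b d -> ~~ con X a b ->
  exists e f, [/\ e \in X, f \in X, crossing e f & ~~ con X e.1 f.1].
Proof.
move=> sX ab bc cd ac bd Nab.
have bin : a < b < c by rewrite ab bc.
have dout : ~~ (a < d < c) by lia.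
have [p [q [bp pq pin qout]]] :=
  connect_exit (P := fun z : 'I_n => a < z < c) bd bin dout.
have bq := connect_trans bp (connect1 pq).
have Nqa : (q : nat) <> a.
  by move=> /val_inj h; move: Nab; rewrite -h con_sym bq.
have Nqc : (q : nat) <> c.
  by move=> /val_inj h; move: Nab; rewrite con_sym (connect_trans bq) // h con_sym.
have [f fX pqE] := con_adj pq.
have bf : con X b f.1 by case: pqE => ->.
have Naf : ~~ con X a f.1.
  by apply: contra Nab => af; rewrite (connect_trans af) // con_sym.
have [e [eX ef ae]] : exists e, [/\ e \in X, crossing e f & con X a e.1].
  have [afin|afout] := boolP (f.1 < a < f.2).
    have cout : ~~ (f.1 < c < f.2) by case: pqE afin => -> /=; clear -pin qout Nqa Nqc; lia.
    exact: crossing_of_exit ac Naf afin cout.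
  have ca : con X c a by rewrite con_sym.
  have Ncf : ~~ con X c f.1.
    by apply: contra Naf; apply: connect_trans.
  have cfin : f.1 < c < f.2.
    have := sX _ fX; case: pqE afout => -> /=; clear -pin qout Nqa Nqc; lia.
  have [e [eX ef ce]] := crossing_of_exit sX fX ca Ncf cfin afout.
  by exists e; split=> //; apply: connect_trans ce.
exists e, f; split=> //; apply: contra Naf; exact: connect_trans.
Qed.

(** The hypothesis on the graph speaks of crossing edges, so the condition on four vertices is
    traded for one on pairs of edges. *)
Lemma noncrossing_bondP X : simple_graph X ->
  reflect (forall e f, e \in X -> f \in X -> crossing e f -> con X e.1 f.1)
          (noncrossing_bond X).
Proof.
move=> sX; apply: (iffP idP) => [nc|h].
  have main e f : e \in X -> f \in X -> e.1 < f.1 -> f.1 < e.2 -> e.2 < f.2 ->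
      con X e.1 f.1.
    move=> eX fX h1 h2 h3; move/forallP/(_ e.1): nc.
    move=> /forallP/(_ f.1)/forallP/(_ e.2)/forallP/(_ f.2)/implyP; apply.
    by rewrite h1 h2 h3 !con_edge.
  move=> e f eX fX /orP[]/and3P[h1 h2 h3]; first exact: main.
  by rewrite con_sym; apply: main.
apply/forallP => a; apply/forallP => b; apply/forallP => c; apply/forallP => d.
apply/implyP => /and5P[ab bc cd ac bd]; apply/negPn/negP => Nab.
have [e [f [eX fX ef]]] := crossing_components sX ab bc cd ac bd Nab.
by rewrite h.
Qed.

(** This is the closure operator of the graphic matroid of [E]; bonds are its flats, as [bondP]
    records. *)
Definition cl E X : {set edge n} := [set e in E | con X e.1 e.2].

Lemma simpleS E X : X \subset E -> simple_graph E -> simple_graph X.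
Proof. by move=> /subsetP sXE sE e /sXE/sE. Qed.

Lemma cl_sub E X : cl E X \subset E.
Proof. by apply/subsetP => e; rewrite inE => /andP[]. Qed.

Lemma sub_cl E X : X \subset E -> X \subset cl E X.
Proof.
by move=> /subsetP sXE; apply/subsetP => e eX; rewrite inE sXE // con_edge.
Qed.

Lemma con_cl E X : X \subset E -> con (cl E X) =2 con X.
Proof.
move=> sXE x y; apply/idP/idP; last exact/conS/sub_cl.
by apply: con_sub => e; rewrite inE => /andP[].
Qed.

Lemma clS E X Y : X \subset Y -> cl E X \subset cl E Y.
Proof.
by move=> sXY; apply/subsetP => e; rewrite !inE => /andP[->] /(conS sXY).
Qed.

Lemma eq_cl E X Y : con X =2 con Y -> cl E X = cl E Y.
Proof. by move=> h; apply/setP => e; rewrite !inE h. Qed.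

Lemma bondP E X : reflect (X \subset E /\ cl E X = X) (is_bond E X).
Proof.
apply: (iffP andP) => [[sXE /forallP h]|[sXE clX]]; split=> //.
  apply/eqP; rewrite eqEsubset sub_cl // andbT; apply/subsetP => e.
  by rewrite inE => /andP[eE ce]; have /implyP/(_ eE)/implyP := h e; apply.
by apply/forall_inP => e eE; apply/implyP => ce; rewrite -clX inE eE.
Qed.

Lemma bond_cl E X : X \subset E -> is_bond E (cl E X).
Proof. by move=> sXE; apply/bondP; split; [exact: cl_sub | exact/eq_cl/con_cl]. Qed.

(** * Noncrossing bonds in a strongly upper crossed graph *)

Section Bonds.
Variables (E : {set edge n}) (le : rel (edge n)).
Hypothesis sE : simple_graph E.

Lemma NC_sub X : isNC E X -> X \subset E.
Proof. by case/andP=> /bondP[]. Qed.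

Lemma NC_cl X : isNC E X -> cl E X = X.
Proof. by case/andP=> /bondP[]. Qed.

Lemma NC_mem X e : isNC E X -> e \in E -> con X e.1 e.2 -> e \in X.
Proof. by move=> /NC_cl {2}<- eE ce; rewrite inE eE. Qed.

Lemma NC_cl_sub X Y : X \subset Y -> isNC E Y -> cl E X \subset Y.
Proof. by move=> sXY /NC_cl <-; apply: clS. Qed.

Lemma NC_crossing X e f : isNC E X -> e \in X -> f \in X -> crossing e f ->
  con X e.1 f.1.
Proof.
by move=> /andP[/bondP[sXE _] /(noncrossing_bondP (simpleS sXE sE))]; apply.
Qed.

(** Closing does not change the components, so crossings need only be tested on the generating set
    [X]. *)
Lemma cl_NC X : X \subset E ->
  (forall e f, e \in X -> f \in X -> crossing e f -> con X e.1 f.1) ->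
  isNC E (cl E X).
Proof.
move=> sXE h; rewrite /isNC bond_cl //=.
have /(noncrossing_bondP (simpleS sXE sE)) : 
  forall e f, e \in X -> f \in X -> crossing e f -> con X e.1 f.1 by [].
rewrite /noncrossing_bond => nc.
apply/forallP => a; apply/forallP => b; apply/forallP => c; apply/forallP => d.
by rewrite !con_cl //; move/forallP/(_ a)/forallP/(_ b)/forallP/(_ c)/forallP/(_ d): nc.
Qed.

Lemma NC0 : isNC E set0.
Proof.
have -> : set0 = cl E set0.
  apply/setP => e; rewrite !inE; apply/esym/negbTE; rewrite negb_and -implybE.
  by apply/implyP => /sE; apply: contraL => /con0 ->; rewrite ltnn.
by apply: cl_NC => [|e f]; rewrite ?sub0set ?inE.
Qed.

Hypothesis tE : total_order_on E le.

(* Position of an edge in the order, so that the order can be compared in nat. *)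
Definition pos e := #|[set f in E | lt_of le f e]|.

Lemma pos_lt e f : e \in E -> f \in E -> lt_of le e f = (pos e < pos f).
Proof.
case: tE => refl anti trans tot eE fE.
have mono (x y : edge n) : x \in E -> y \in E -> lt_of le x y -> pos x < pos y.
  move=> xE yE /andP[lxy Nxy]; apply/proper_card/properP; split.
    apply/subsetP => z; rewrite !inE => /and3P[zE lzx Nzx]; rewrite zE /=.
    rewrite /lt_of (trans z x y) //=; apply: contraNneq Nzx => zy; apply/eqP.
    by apply: anti => //; rewrite zy.
  by exists x; rewrite !inE xE /lt_of ?lxy ?Nxy ?eqxx ?andbF.
apply/idP/idP; first exact: mono.
apply: contraTT; rewrite /lt_of negb_and negbK -leqNgt => /orP[Nle|/eqP->//].
apply: ltnW; apply: mono => //; rewrite /lt_of.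
have := tot _ _ eE fE; rewrite (negbTE Nle) /= => ->.
by apply: contraNneq Nle => ->; apply: refl.
Qed.

Lemma pos_inj : {in E &, injective pos}.
Proof.
case: tE => refl anti trans tot e f eE fE pE; apply/eqP; apply: contraT => Nef.
have := pos_lt eE fE; have := pos_lt fE eE; rewrite pE ltnn /lt_of Nef eq_sym Nef.
by have := tot _ _ eE fE; case: (le e f); case: (le f e).
Qed.

Lemma pos_le e f : e \in E -> f \in E -> le e f = (pos e <= pos f).
Proof.
case: tE => refl anti trans tot eE fE.
have [->|Nef] := eqVneq e f; first by rewrite leqnn; apply: refl.
have := pos_lt eE fE; rewrite /lt_of Nef andbT => ->.
rewrite ltn_neqAle; case: eqP => //= h.
by move: Nef; rewrite (pos_inj eE fE h) eqxx.
Qed.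

Hypothesis suc : strongly_upper_crossed E le.

(** The block of [Y] containing both edges is a connected induced subgraph of the whole graph. It
    therefore contains a minimal one around [e] and [f], to which the hypothesis on the order
    applies. *)
Lemma crossing_hull Y e f : isNC E Y -> e \in Y -> f \in Y -> crossing e f ->
  exists X, [/\ X \subset Y, con X e.1 f.1 &
    forall g, g \in X -> g != e -> g != f -> pos g < pos e /\ pos g < pos f].
Proof.
move=> ncY eY fY ef; have /subsetP sYE := NC_sub ncY.
have c_ef := NC_crossing ncY eY fY ef.
pose C := comp Y e.1.
have cC : conn_ind_containing E e f C.
  rewrite /conn_ind_containing !in_comp connect0 con_edge // c_ef.
  rewrite (connect_trans c_ef (con_edge fY)) /=.
  have hub u : con Y e.1 u -> con (induced E C) e.1 u.
    apply: (connect_ind (P := fun u => con (induced E C) e.1 u)) => //.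
    move=> p q ep pq; move/connect_trans; apply.
    have eq := connect_trans ep (connect1 pq).
    have [g gY pqE] := con_adj pq.
    have gC : g \in induced E C.
      by rewrite inE sYE // !in_comp; case: pqE => -> /=; rewrite ep eq.
    by have := con_edge gC; case: pqE => -> //=; rewrite con_sym.
  apply/forall_inP => u; rewrite in_comp => /hub eu.
  apply/forall_inP => v; rewrite in_comp => /hub.
  by apply: connect_trans; rewrite con_sym.
have [S /minsetP[cS minS] sSC] := minset_exists cC.
have mS : minimal_cic E e f S.
  rewrite /minimal_cic cS; apply/forall_inP => S' /andP[sS' NsS'].
  by apply: contra NsS' => /minS ->.
have [_ /(_ S mS) lows] := suc (sYE _ eY) (sYE _ fY) ef.
exists (induced E S); split.
- apply/subsetP => g; rewrite inE => /and3P[gE /(subsetP sSC) g1 /(subsetP sSC) g2].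
  apply: NC_mem ncY gE _; move: g1 g2; rewrite !in_comp con_sym.
  exact: connect_trans.
- case/and5P: cS => e1 e2 f1 f2 /forall_inP/(_ _ e1)/forall_inP; exact.
move=> g gS Nge Ngf; have /andP[] := lows g gS Nge Ngf.
have gE : g \in E by move: gS; rewrite inE => /andP[].
by rewrite !pos_lt // ?sYE.
Qed.

(** Crossing edges have four distinct ends, so [e] and [f] alone cannot connect each other; the hull
    must have a third edge. *)
Lemma crossing_smaller Y e f : isNC E Y -> e \in Y -> f \in Y -> crossing e f ->
  exists g, [/\ g \in Y, pos g < pos e & pos g < pos f].
Proof.
move=> ncY eY fY ef; have [X [sXY cef lows]] := crossing_hull ncY eY fY ef.
have [/existsP[g /and3P[gX Nge Ngf]]|none] :=
    boolP [exists g, [&& g \in X, g != e & g != f]].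
  by exists g; have [] := lows g gX Nge Ngf; split=> //; apply: (subsetP sXY).
have sX : X \subset e |: (f |: set0).
  apply/subsetP => g gX; rewrite !inE orbF.
  by move/existsPn/(_ g): none; rewrite gX /= negb_and !negbK.
have Ncf x : x != f.1 -> x != f.2 -> con (f |: set0) x f.1 = false.
  move=> N1 N2; rewrite conU1; apply/negbTE/negP.
  by case/or3P=> [|/andP[]|/andP[]] /con0 h; rewrite h eqxx in N1 N2.
have := conS sX cef; rewrite conU1.
have [N1 N2 N3 N4] : [/\ e.1 != f.1, e.1 != f.2, e.2 != f.1 & e.2 != f.2].
  move: ef; rewrite /crossing -!(inj_eq val_inj) /=; clear => ef; split; lia.
by rewrite !Ncf // !andbF.
Qed.

(** Two crossing edges lie in a connected induced subgraph, hence in the same component. This gives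
    the poset its top element. *)
Lemma NC_E : isNC E E.
Proof.
have /bondP[_ clE] : is_bond E E.
  by rewrite /is_bond subxx; apply/forall_inP => e ->; rewrite implybT.
rewrite -{2}clE; apply: cl_NC => // e f eE fE ef.
have [[S mS] _] := suc eE fE ef.
have /andP[/and5P[e1 e2 f1 f2 /forall_inP/(_ _ e1)/forall_inP/(_ _ f1) c] _] := mS.
by apply: conS c; apply/subsetP => g; rewrite inE => /andP[].
Qed.

Lemma NC_merge X Y m : isNC E X -> isNC E Y -> X \subset Y -> m \in Y ->
  (forall g, g \in Y :\: X -> pos m <= pos g) -> isNC E (cl E (m |: X)).
Proof.
move=> ncX ncY sXY mY min_m.
have mXY : m |: X \subset Y by rewrite subUset sub1set mY.
apply: cl_NC; first exact: subset_trans (NC_sub ncY).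
have main f : f \in X -> crossing m f -> con (m |: X) m.1 f.1.
  move=> fX mf; have [Z [sZY cmf lows]] := crossing_hull ncY mY (subsetP sXY _ fX) mf.
  apply: conS cmf; apply/subsetP => g gZ; rewrite !inE.
  have [//|Ngm] := eqVneq g m; have [->|Ngf] := eqVneq g f; first exact: fX.
  have [] := lows g gZ Ngm Ngf; rewrite ltnNge => Nmg _.
  (* An edge of [Y] that precedes [m] cannot lie in [Y :\: X], so it lies in [X]. *)
  by apply: contraNT Nmg => NgX; apply: min_m; rewrite inE NgX (subsetP sZY).
move=> e f /setU1P[->|eX] /setU1P[->|fX] ef.
- exact: connect0.
- exact: main.
- by rewrite con_sym; apply: main; rewrite // crossingC.
- by apply: conS (NC_crossing ncX eX fX ef); apply: subsetUr.
Qed.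

End Bonds.

End Graph.

(** * Covers, grading and the minimum labeling *)

Section Poset.
Variables (n : nat) (E : {set edge n}) (le : rel (edge n)).
Hypotheses (sE : simple_graph E) (tE : total_order_on E le)
  (suc : strongly_upper_crossed E le).
Implicit Types (X Y Z S : {set edge n}) (e f g m : edge n).
Implicit Types s : seq {set edge n}.

Local Notation pos := (pos E le).
Local Notation mer m X := (cl E (m |: X)).

Lemma mlabP X Y : X \proper Y -> Y \subset E ->
  exists m, [/\ mlab le X Y = Some m, m \in Y, m \notin X &
    forall g, g \in Y :\: X -> pos m <= pos g].
Proof.
move=> /properP[sXY [g0 g0Y Ng0X]] /subsetP sYE; rewrite /mlab.
have DE g : g \in Y :\: X -> g \in E by rewrite inE => /andP[_ /sYE].
case: pickP => [m /andP[mD /forall_inP min_m]|none].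
  exists m; split=> //; try by move: mD; rewrite inE => /andP[].
  by move=> g gD; rewrite -(pos_le tE) ?DE // min_m.
have g0D : g0 \in Y :\: X by rewrite inE Ng0X.
case: (arg_minnP pos g0D) => m mD min_m.
have /andP[] := none m; split=> //; apply/forall_inP => g gD.
by rewrite (pos_le tE) ?DE // min_m.
Qed.

Lemma mlab_eq X Y m : Y \subset E -> m \in Y -> m \notin X ->
  (forall g, g \in Y :\: X -> pos m <= pos g) -> mlab le X Y = Some m.
Proof.
move=> sYE mY NmX min_m; rewrite /mlab.
have mD : m \in Y :\: X by rewrite inE NmX.
have DE g : g \in Y :\: X -> g \in E by rewrite inE => /andP[_ /(subsetP sYE)].
case: pickP => [m' /andP[m'D /forall_inP min_m']|/(_ m)/negP[]].
  congr Some; apply: (pos_inj tE); rewrite ?DE //.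
  by apply/eqP; rewrite eqn_leq min_m // -(pos_le tE) ?DE // min_m'.
rewrite mD; apply/forall_inP => g gD; by rewrite (pos_le tE) ?DE // min_m.
Qed.

Lemma leq_rk X Y : X \subset Y -> rk X <= rk Y.
Proof. by move=> sXY; apply/leq_sub2l/leq_cc. Qed.

Lemma rhoP_E : rhoP E = rk E.
Proof.
apply/eqP; rewrite eqn_leq; apply/andP; split.
  by apply/bigmax_leqP => X /NC_sub; apply: leq_rk.
exact/leq_bigmax_cond/(NC_E sE suc).
Qed.

Lemma merge_sub X m : m \in E -> X \subset E -> m |: X \subset E.
Proof. by move=> mE sXE; rewrite subUset sub1set mE. Qed.

Lemma mem_merge X m : m \in E -> X \subset E -> m \in mer m X.
Proof. by move=> mE sXE; apply: (subsetP (sub_cl _)); rewrite ?merge_sub ?setU11. Qed.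

Lemma sub_merge X m : m \in E -> X \subset E -> X \subset mer m X.
Proof.
by move=> mE sXE; apply: subset_trans (subsetUr _ _) (sub_cl _); exact: merge_sub.
Qed.

Lemma rk_merge X m : isNC E X -> m \in E -> m \notin X -> rk (mer m X) = (rk X).+1.
Proof.
move=> ncX mE NmX.
have Nc : ~~ con X m.1 m.2 by apply: contra NmX; apply: (NC_mem ncX).
rewrite /rk (eq_cc (con_cl (merge_sub mE (NC_sub ncX)))).
by have := cc_leq X; rewrite (ccU1 Nc); lia.
Qed.

(** A bond [W] strictly above [X] and inside the merge has an edge [w] joining the two merged
    blocks. Through [w] it connects the ends of [m], so it already contains the whole merge. *)
Lemma covers_merge X m : isNC E X -> isNC E (mer m X) -> m \in E -> m \notin X ->
  covers E X (mer m X).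
Proof.
move=> ncX ncZ mE NmX; have sXE := NC_sub ncX.
have sXZ := sub_merge mE sXE.
apply/and4P; split=> //.
  by apply/properP; split=> //; exists m; rewrite // mem_merge.
apply/forallP => W; apply/negP => /and3P[ncW /properP[sXW [w wW NwX]]].
case/properP=> sWZ [z zZ]; case/negP.
have wE := subsetP (NC_sub ncW) w wW.
have := subsetP sWZ w wW; rewrite inE wE /= conU1.
have /negbTE-> /= : ~~ con X w.1 w.2 by apply: contra NwX; apply: (NC_mem ncX).
have cw := con_edge wW => h.
apply: subsetP z zZ; apply: NC_cl_sub => //.
rewrite subUset sXW sub1set andbT; apply: (NC_mem ncW) => //.
case/orP: h => /andP[/(conS sXW) h1 /(conS sXW) h2].
  apply: (connect_trans _ (connect_trans cw _)); by rewrite con_sym.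
rewrite con_sym in cw; exact: connect_trans h2 (connect_trans cw h1).
Qed.

Lemma greedy_cover X Y : isNC E X -> isNC E Y -> X \proper Y ->
  exists m, [/\ m \in Y, m \notin X, forall g, g \in Y :\: X -> pos m <= pos g,
    covers E X (mer m X) & mer m X \subset Y].
Proof.
move=> ncX ncY pXY; have sYE := NC_sub ncY.
have [m [_ mY NmX min_m]] := mlabP pXY sYE.
have ncZ := NC_merge sE tE suc ncX ncY (proper_sub pXY) mY min_m.
exists m; split=> //; first by apply: covers_merge => //; apply: (subsetP sYE).
by apply: NC_cl_sub; rewrite // subUset sub1set mY proper_sub.
Qed.

(** The greedy merge fits between [X] and [Y], so a cover leaves no choice but that merge.
    Consequently a cover raises the rank by one and is determined by its label. *)
Lemma covers_min X Y : covers E X Y ->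
  exists m, [/\ mlab le X Y = Some m, m \in Y, m \notin X,
    forall g, g \in Y :\: X -> pos m <= pos g & Y = mer m X].
Proof.
case/and4P=> ncX ncY pXY /forallP noW; have sYE := NC_sub ncY.
have [m [mY NmX min_m covZ sZY]] := greedy_cover ncX ncY pXY.
exists m; split=> //; first exact: mlab_eq.
apply/eqP; rewrite eq_sym; have := noW (mer m X).
by case/and4P: covZ => _ -> -> _; rewrite properEneq sZY andbT negbK.
Qed.

Lemma mlab_merge X Y m : Y \subset E -> m \in Y -> m \notin X -> X \subset Y ->
  (forall g, g \in Y :\: X -> pos m <= pos g) -> mer m X \subset Y ->
  mlab le X (mer m X) = Some m.
Proof.
move=> sYE mY NmX sXY min_m sZY; apply: mlab_eq => //; first exact: cl_sub.
  by rewrite mem_merge ?(subsetP sYE) ?(subset_trans sXY).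
by move=> g; rewrite !inE => /andP[NgX gZ]; apply: min_m; rewrite inE NgX (subsetP sZY) ?inE.
Qed.

Lemma covers_rk X Y : covers E X Y -> rk Y = (rk X).+1.
Proof.
move=> cXY; have [m [_ mY NmX _ ->]] := covers_min cXY.
case/and4P: cXY => ncX /NC_sub/subsetP sYE _ _.
by rewrite rk_merge // sYE.
Qed.

Lemma rk_proper X Y : isNC E X -> isNC E Y -> X \proper Y -> rk X < rk Y.
Proof.
move=> ncX ncY pXY; have [m [_ _ _ cXZ /leq_rk]] := greedy_cover ncX ncY pXY.
by rewrite (covers_rk cXZ).
Qed.

Lemma NC_rk_eq X Y : isNC E X -> isNC E Y -> X \subset Y -> rk X = rk Y -> X = Y.
Proof.
move=> ncX ncY sXY rXY; apply/eqP; apply: contraT => NXY.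
by have := @rk_proper X Y ncX ncY; rewrite properEneq NXY sXY rXY ltnn => /(_ isT).
Qed.

Lemma rk_covers X Y : isNC E X -> isNC E Y -> X \subset Y -> rk Y = (rk X).+1 ->
  covers E X Y.
Proof.
move=> ncX ncY sXY rXY.
have pXY : X \proper Y.
  by rewrite properEneq sXY andbT; apply/eqP => XY; move: rXY; rewrite XY; lia.
have [m [_ _ _ cXZ sZY]] := greedy_cover ncX ncY pXY.
case/and4P: (cXZ) => _ ncZ _ _.
by rewrite -(NC_rk_eq ncZ ncY) // rXY (covers_rk cXZ).
Qed.

Lemma covers_NC X Y : covers E X Y -> isNC E X /\ isNC E Y.
Proof. by case/and4P. Qed.

Lemma covers_mlab_inj X Y Z : covers E X Y -> covers E X Z ->
  mlab le X Y = mlab le X Z -> Y = Z.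
Proof. by do 2![case/covers_min=> ? [-> _ _ _ ->]] => -[->]. Qed.

Lemma path_covers X s : isNC E X -> path (covers E) X s ->
  isNC E (last X s) /\ X \subset last X s.
Proof.
elim: s X => [|Y s IH] X ncX; first by split=> //; apply: subxx.
case/andP=> /and4P[_ ncY /proper_sub sXY _] /(IH _ ncY)[ncl sYl].
by split=> //; apply: subset_trans sXY sYl.
Qed.

(** At the step where [g] enters the chain, [g] competes for the minimum that defines the label. *)
Lemma label_leq X s g : path (covers E) X s -> g \in last X s -> g \notin X ->
  exists m, [/\ Some m \in labels le X s, m \in E & pos m <= pos g].
Proof.
elim: s X => [|Y s IH] X /=; first by move=> _ ->.
case/andP=> cXY pY gl NgX; have [m [-> mY _ min_m _]] := covers_min cXY.
have [gY|NgY] := boolP (g \in Y).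
  exists m; rewrite inE eqxx min_m ?inE ?NgX //; split=> //.
  by case/covers_NC: cXY => _ /NC_sub/subsetP; apply.
by have [m' [m'l m'E le_m']] := IH _ pY gl NgY; exists m'; rewrite inE m'l orbT.
Qed.

Lemma label_mem X s m : isNC E X -> path (covers E) X s ->
  Some m \in labels le X s -> (m \in last X s) && (m \notin X).
Proof.
elim: s X => [|Y s IH] X ncX //= /andP[cXY pY].
have [m' [-> m'Y Nm'X _ _]] := covers_min cXY.
have [_ ncY] := covers_NC cXY; have [_ sYl] := path_covers ncY pY.
rewrite inE => /orP[/eqP[->]|/(IH _ ncY pY)/andP[-> NmY]].
  by rewrite (subsetP sYl).
by apply: contra NmY; apply/subsetP; case/and4P: cXY => _ _ /proper_sub.
Qed.

Lemma label_some X s : path (covers E) X s -> None \notin labels le X s.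
Proof.
elim: s X => [|Y s IH] X //= /andP[/covers_min[m [-> _ _ _ _]] /IH].
by rewrite inE.
Qed.

Lemma labels_inj X s s' : path (covers E) X s -> path (covers E) X s' ->
  labels le X s = labels le X s' -> s = s'.
Proof.
elim: s s' X => [|Y s IH] [|Y' s'] X //= /andP[cXY pY] /andP[cXY' pY'] [].
move=> lE lsE; have YE := covers_mlab_inj cXY cXY' lE.
by rewrite -YE in pY' lsE *; rewrite (IH _ _ pY pY').
Qed.

Lemma lt_lab_pos e f : e \in E -> f \in E ->
  lt_lab le (Some e) (Some f) = (pos e < pos f).
Proof. exact: pos_lt. Qed.

(** [le] is an order on [E] only, so transitivity is restricted to labels that are edges of [E]. *)
Lemma lt_lab_trans_in : {in [pred a | if a is Some e then e \in E else false] & &,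
  transitive (lt_lab le)}.
Proof.
by move=> [f|] [e|] [g|] //; rewrite !inE => fE eE gE; rewrite !lt_lab_pos //; apply: ltn_trans.
Qed.

(** Induction on the number of edges between [X] and [Y]: the increasing chain starts with the
    greedy merge [Z] and continues with the increasing chain from [Z] to [Y]. *)
Lemma min_labeling_EL : EL_labeling E le.
Proof.
move=> X Y ncX ncY; have [k] := ubnP (#|Y| - #|X|).
elim: k X ncX => // k IH X ncX leYX sXY.
have [XY|NXY] := eqVneq X Y.
  exists [::]; split=> [||[|Z s]]; rewrite ?/sat_chain /= ?XY ?eqxx //.
  case/andP=> /andP[cXZ pZ] /eqP lZ; case/and4P: cXZ => _ ncZ /properP[_ [z zZ]].
  have [_ /subsetP/(_ z zZ)] := path_covers ncZ pZ.
  by rewrite lZ => ->.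
have pXY : X \proper Y by rewrite properEneq NXY.
have [m [mY NmX min_m cXZ sZY]] := greedy_cover ncX ncY pXY.
set Z := mer m X in cXZ sZY.
have mE := subsetP (NC_sub ncY) m mY.
have lZ := mlab_merge (NC_sub ncY) mY NmX (proper_sub pXY) min_m sZY.
rewrite -/Z in lZ.
have [_ ncZ] := covers_NC cXZ.
have ltk : #|Y| - #|Z| < k.
  have : #|X| < #|Z| by case/and4P: cXZ => _ _ /proper_card.
  by have := subset_leq_card sZY; clear -leYX; lia.
have [s [cs is_s uniq_s]] := IH Z ncZ ltk sZY.
exists (Z :: s); split.
- by rewrite /sat_chain /= cXZ.
- case/andP: cs => ps /eqP ls; rewrite /increasing /= lZ.
  case: s ps ls is_s {uniq_s} => [|W s] //= /andP[cZW pW] ls; rewrite /increasing /= => ->.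
  rewrite andbT; have [w [-> wW NwZ _ _]] := covers_min cZW.
  have [_ ncW] := covers_NC cZW; have [_ /subsetP/(_ w wW)] := path_covers ncW pW.
  rewrite ls => wY; have NwX : w \notin X.
    by apply: contra NwZ; apply/subsetP; case/and4P: cXZ => _ _ /proper_sub.
  (* The first label [w] of the tail lies outside [Z] while [m] lies in it, so the inequality given
     by minimality of [m] is strict. *)
  rewrite (pos_lt tE) // ?(subsetP (NC_sub ncY)) // ltn_neqAle min_m ?inE ?NwX //.
  rewrite andbT; apply: contraNneq NwZ => /(pos_inj tE) <- //.
    by rewrite mem_merge // NC_sub.
  exact: (subsetP (NC_sub ncY)).
case=> [|Z' s'] /andP[/= cs' /eqP ls'].
  by rewrite ls' eqxx in NXY.
case/andP: cs' => cXZ' pZ' Nss.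
have [ZZ'|NZZ'] := eqVneq Z' Z.
  rewrite ZZ' in pZ' ls' Nss *.
  have cs' : sat_chain E Z Y s' by rewrite /sat_chain pZ' ls' eqxx.
  have Nss' : s' <> s by move=> h; apply: Nss; rewrite h.
  have [Ninc [i [i1 i2 i3]]] := uniq_s s' cs' Nss'.
  split; first by apply: contra Ninc; rewrite /increasing /=; apply: path_sorted.
  exists i.+1; split=> //=; first by rewrite i2.
  by case: i3 => [->|[? ?]]; [left | right].
have [m' [lZ' m'Z' Nm'X min_m' Z'E]] := covers_min cXZ'.
have [_ ncZ'] := covers_NC cXZ'.
have [_ sZ'Y] := path_covers ncZ' pZ'; rewrite ls' in sZ'Y.
have m'Y := subsetP sZ'Y _ m'Z'; have m'E := subsetP (NC_sub ncY) _ m'Y.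
have mm' : pos m < pos m'.
  rewrite ltn_neqAle min_m ?inE ?Nm'X // andbT.
  by apply: contraNneq NZZ' => /(pos_inj tE mE m'E) h; rewrite Z'E -h.
split; last first.
  by exists 0; split=> //=; right; rewrite lZ lZ' lt_lab_pos.
(* A chain starting with another cover must still pick up [m], and does so under a label at most
   [m], hence below its first label [m']. *)
have [m0 [m0l m0E le_m0]] : exists m0, [/\ Some m0 \in labels le X (Z' :: s'),
    m0 \in E & pos m0 <= pos m].
  by apply: label_leq; rewrite /= ?cXZ' ?ls'.
rewrite /increasing /=; apply/negP; rewrite /= lZ' => inc.
have aP : all [pred a | if a is Some e then e \in E else false] (Some m' :: labels le Z' s').
  rewrite /= m'E; apply/allP => -[e|] /=; last by rewrite (negbTE (label_some pZ')).
  by move/(label_mem ncZ' pZ')/andP=> []; rewrite ls' => /(subsetP (NC_sub ncY)).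
have := sorted_ltn_nth_in lt_lab_trans_in None aP inc.
move: m0l; rewrite /= lZ' => /[dup] m0l; rewrite -index_mem => i_lt.
move/(_ 0 (index (Some m0) (Some m' :: labels le Z' s')) isT i_lt).
rewrite nth_index //= (pos_lt tE) //; case: eqP => [[h]|_].
  by move: le_m0; rewrite -h leqNgt mm'.
by move=> /(_ isT)/leq_trans/(_ le_m0); rewrite ltnNge (ltnW mm').
Qed.

End Poset.

(** * Cycles and simple paths *)

Section Cycles.
Variable n : nat.
Implicit Types (E X S C : {set edge n}) (e g : edge n) (x y : 'I_n).
Implicit Type p : seq 'I_n.

Lemma zip_belast x y p :
  zip (x :: p) (rcons p y) = rcons (zip (belast x p) p) (last x p, y).
Proof. by elim: p x => //= z p IH x; rewrite IH. Qed.

Lemma path_zip (r : rel 'I_n) x p :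
  path r x p = all (fun q => r q.1 q.2) (zip (belast x p) p).
Proof. by elim: p x => //= z p IH x; rewrite IH. Qed.

Lemma con_path_zip X x p : (forall q, q \in zip (belast x p) p -> con X q.1 q.2) ->
  con X x (last x p).
Proof.
elim: p x => [|z p IH] x h /=; first exact: connect0.
apply: connect_trans (IH _ _); first by apply: (h (x, z)); rewrite inE eqxx.
by move=> q qp; apply: h; rewrite inE qp orbT.
Qed.

Lemma mem_zip1 x y (s t : seq 'I_n) : (x, y) \in zip s t -> x \in s /\ y \in t.
Proof.
elim: s t => [|a s IH] [|b t] //=; rewrite !inE => /orP[/eqP[-> ->]|/IH[-> ->]].
  by rewrite !eqxx.
by rewrite !orbT.
Qed.

Lemma mkedge_id e : e.1 < e.2 -> mkedge e.2 e.1 = e /\ mkedge e.1 e.2 = e.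
Proof. by case: e => a b /= ab; rewrite /mkedge ab ltnNge (ltnW ab). Qed.

Lemma mkedge_adj E x y : simple_graph E -> adj E x y -> mkedge x y \in E.
Proof.
by move=> sE /orP[] xyE; have /mkedge_id[h1 h2] := sE _ xyE; rewrite (h1, h2).
Qed.

Lemma con_mkedge X x y : mkedge x y \in X -> con X x y.
Proof.
by rewrite /mkedge; case: ifP => _ /con_edge //=; rewrite con_sym.
Qed.

Lemma con_mkedgeE X x y : con X (mkedge x y).1 (mkedge x y).2 = con X x y.
Proof. by rewrite /mkedge; case: ifP => _ //=; rewrite con_sym. Qed.

Lemma mkedge_inj x y x' y' : mkedge x y = mkedge x' y' ->
  (x = x' /\ y = y') \/ (x = y' /\ y = x').
Proof. by rewrite /mkedge; case: ifP => _; case: ifP => _ [-> ->]; auto. Qed.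

Lemma zip_rot (s t : seq 'I_n) i : size s = size t ->
  zip (rot i s) (rot i t) = rot i (zip s t).
Proof.
have zip_take k : zip (take k s) (take k t) = take k (zip s t).
  by elim: k s t => [|k IH] [|a s] [|b t] //=; rewrite IH.
have zip_drop k : zip (drop k s) (drop k t) = drop k (zip s t).
  by elim: k s t {zip_take} => [|k IH] [|a s] [|b t] //=; case: drop.
by move=> st; rewrite /rot zip_cat ?size_drop ?st // zip_take zip_drop.
Qed.

Lemma zip_rot1_rot (s : seq 'I_n) i :
  zip (rot i s) (rot 1 (rot i s)) = rot i (zip s (rot 1 s)).
Proof. by rewrite rot_rot zip_rot // size_rot. Qed.

Lemma cycle_rot (s : seq 'I_n) i : cycle_edges (rot i s) = cycle_edges s.
Proof.
rewrite /cycle_edges zip_rot1_rot; apply/setP => e.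
by apply/imsetP/imsetP => -[q]; rewrite ?mem_rot => qz ->; exists q; rewrite ?mem_rot.
Qed.

(** Rotate the vertex list so that it starts at one end of [e] and finishes at the other; the
    remaining consecutive pairs form a path between these ends. *)
Lemma cycle_con E C e : is_cycle E C -> e \in C -> con (C :\ e) e.1 e.2.
Proof.
case/existsP=> k /existsP[t /and4P[ut k2 /eqP CE _]].
have st : 2 < size t by rewrite size_tuple.
rewrite {}CE; move: (tval t) ut st => {k k2 t} t ut st /imsetP[[u v] uvt ->] /=.
have [_] := mem_zip1 uvt; rewrite mem_rot => /rot_to[i p tE].
rewrite con_mkedgeE -(cycle_rot t i) tE.
have uvp : (u, v) \in zip (v :: p) (rcons p v).
  have -> : rcons p v = rot 1 (rot i t) by rewrite tE rot1_cons.
  by rewrite -tE zip_rot1_rot mem_rot.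
have : uniq (v :: p) by rewrite -tE rot_uniq.
have : 2 < size (v :: p) by rewrite -tE size_rot.
move: uvp; rewrite zip_belast mem_rcons inE => /orP[/eqP[->]|/mem_zip1[_ vp]]; last first.
  by move=> _ /=; rewrite vp.
move=> sp up.
rewrite con_sym; apply: con_path_zip => -[a b] abp.
apply: con_mkedge; rewrite in_setD1; apply/andP; split; last first.
  apply/imsetP; exists (a, b) => //.
  by rewrite rot1_cons zip_belast mem_rcons inE abp orbT.
have [ap bp] := mem_zip1 abp.
have Nbv : b != v by apply: contraTneq up => <- /=; rewrite bp.
have Nal : a != last v p.
  by move: up; rewrite lastI rcons_uniq => /andP[+ _]; apply: contraNneq => <-.
(* A path edge equal to [e] read backwards would run from [v] straight to the last vertex, leaving
   only two vertices on the cycle. *)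
apply/eqP => /mkedge_inj[[/eqP]|[av bl]]; first by rewrite (negbTE Nal).
case: p abp sp up bl {tE Nbv Nal ap bp} => [|z p] //=; rewrite /= in av; rewrite av inE.
case/orP=> [/eqP[->]|/mem_zip1[/mem_belast vp _]]; last by rewrite vp.
by case: p => [|w p] //= _ /and3P[_ zp _] zl; rewrite zl mem_last in zp.
Qed.

(** Shorten the walk in [S] to a simple path and close it with [g]. *)
Lemma cycle_of_con E g (S : {set edge n}) : simple_graph E -> g \in E -> S \subset E ->
  g \notin S -> con S g.1 g.2 ->
  exists C, [/\ is_cycle E C, g \in C & C :\ g \subset S].
Proof.
move=> sE gE sSE NgS /connectP[p0 pS gp0].
case/shortenP: pS gp0 => p pS up _ gp.
have [h21 h12] := mkedge_id (sE _ gE).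
have adjm (q : 'I_n * 'I_n) : q \in zip (belast g.1 p) p -> mkedge q.1 q.2 \in S.
  move: pS; rewrite path_zip => /allP h /h; apply: mkedge_adj.
  exact: simpleS sSE sE.
exists (cycle_edges (g.1 :: p)).
have memC c : c \in cycle_edges (g.1 :: p) -> c = g \/ c \in S.
  case/imsetP=> q; rewrite rot1_cons zip_belast mem_rcons inE.
  by case/orP=> [/eqP->|/adjm cS] ->; [left; rewrite /= -gp | right].
have gC : g \in cycle_edges (g.1 :: p).
  apply/imsetP; exists (last g.1 p, g.1); last by rewrite /= -gp.
  by rewrite rot1_cons zip_belast mem_rcons inE eqxx.
split=> //; last first.
  by apply/subsetP => c; rewrite in_setD1 => /andP[Ncg /memC[cg|//]]; rewrite cg eqxx in Ncg.
have sn : size (g.1 :: p) < n.+1.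
  by rewrite ltnS -[X in _ <= X]card_ord -(card_uniqP up) max_card.
(* A path with no edge would make [g] a loop, and a path with one edge would be [g] itself, which is
   not in [S]. *)
have s2 : 2 < size (g.1 :: p).
  case: p pS up gp adjm {sn memC gC} => [|z [|w p]] //=.
    by move=> _ _ g21; have := sE _ gE; rewrite g21 ltnn.
  move=> _ _ gz /(_ (g.1, z)); rewrite inE eqxx -gz h12 => /(_ isT).
  by rewrite (negbTE NgS).
apply/existsP; exists (Ordinal sn); apply/existsP; exists (in_tuple (g.1 :: p)).
apply/and4P; split=> //; apply/subsetP => c /memC[->//|]; exact: subsetP.
Qed.

End Cycles.

(** * Noncrossing NBC sets and decreasing chains *)

Section BrokenCircuits.
Variables (n : nat) (E : {set edge n}) (le : rel (edge n)).
Hypotheses (sE : simple_graph E) (tE : total_order_on E le)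
  (suc : strongly_upper_crossed E le).
Implicit Types (X Y Z S C : {set edge n}) (e f g m : edge n).
Implicit Types s : seq {set edge n}.

Local Notation pos := (pos E le).

Lemma cycle_sub C : is_cycle E C -> C \subset E.
Proof. by case/existsP=> k /existsP[t /and4P[]]. Qed.

Lemma nbcP S : reflect (forall C e, is_cycle E C -> e \in C ->
    (forall f, f \in C -> pos e <= pos f) -> ~~ (C :\ e \subset S))
  (nbc E le S).
Proof.
apply: (iffP forallP) => [h C e cC eC min_e|h C].
  have CE := subsetP (cycle_sub cC).
  have /implyP/(_ cC)/forall_inP/(_ e eC)/implyP := h C; apply.
  by apply/forall_inP => f fC; rewrite (pos_le tE) ?CE // min_e.
apply/implyP => cC; apply/forall_inP => e eC; apply/implyP => /forall_inP min_e.
have CE := subsetP (cycle_sub cC).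
by apply: h => // f fC; rewrite -(pos_le tE) ?CE // min_e.
Qed.

Lemma ncnbcP X S : reflect [/\ S \subset X, nbc E le S &
    forall e f, e \in S -> f \in S -> ~~ crossing e f] (ncnbc_set E le X S).
Proof.
apply: (iffP and3P) => -[sSX nbS ncS]; split=> //.
  by move=> e f eS fS; move/forall_inP/(_ e eS)/forall_inP/(_ f fS): ncS.
by apply/forall_inP => e eS; apply/forall_inP => f; apply: ncS.
Qed.

Lemma nbcS S S' : S' \subset S -> nbc E le S -> nbc E le S'.
Proof.
move=> sS /nbcP nbS; apply/nbcP => C e cC eC min_e.
by apply: contra (nbS C e cC eC min_e) => /subset_trans; apply.
Qed.

Lemma ncnbcS X Y S S' : S' \subset S -> S' \subset Y -> ncnbc_set E le X S ->
  ncnbc_set E le Y S'.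
Proof.
move=> sS sSY /ncnbcP[_ nbS ncS]; apply/ncnbcP; split=> //.
  exact: nbcS nbS.
by move=> e f /(subsetP sS) eS /(subsetP sS); apply: ncS.
Qed.

(* Joining the ends of [g] by later edges would close a cycle whose broken
   circuit lies in [S]. *)
Lemma nbc_con S S' g : nbc E le S -> S \subset E -> S' \subset S -> g \in E ->
  (forall f, f \in S' -> pos g < pos f) -> ~~ con S' g.1 g.2.
Proof.
move=> /nbcP nbS sSE sS' gE low; apply/negP => cg.
have NgS' : g \notin S' by apply/negP => /low; rewrite ltnn.
have [C [cC gC sCg]] := cycle_of_con sE gE (subset_trans sS' sSE) NgS' cg.
have min_g f : f \in C -> pos g <= pos f.
  move=> fC; have [->//|Nfg] := eqVneq f g.
  by apply/ltnW/low/(subsetP sCg); rewrite in_setD1 Nfg.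
by case/negP: (nbS C g cC gC min_g); apply: subset_trans sCg sS'.
Qed.

Lemma nbc_rem S m : nbc E le S -> S \subset E -> m \in S ->
  (forall f, f \in S -> pos m <= pos f) -> ~~ con (S :\ m) m.1 m.2.
Proof.
move=> nbS sSE mS min_m.
apply: (nbc_con nbS) => //; rewrite ?subsetDl ?(subsetP sSE) //.
move=> f; rewrite in_setD1 => /andP[Nfm fS]; rewrite ltn_neqAle min_m // andbT.
by apply: contraNneq Nfm => /(pos_inj tE) -> //; rewrite (subsetP sSE).
Qed.

Lemma set_min S : S != set0 ->
  exists2 m, m \in S & forall f, f \in S -> pos m <= pos f.
Proof. by case/set0Pn=> e eS; case: (arg_minnP pos eS) => m; exists m. Qed.

(** NBC sets are forests: removing the least edge separates its ends, by [nbc_rem], and so creates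
    exactly one new component. *)
Lemma cc_nbc S : nbc E le S -> S \subset E -> cc S + #|S| = n.
Proof.
have [k] := ubnP #|S|; elim: k S => // k IH S ltS nbS sSE.
have [->|] := eqVneq S set0; first by rewrite cc0 cards0 addn0.
case/set_min=> m mS min_m.
have Nc := nbc_rem nbS sSE mS min_m.
have := ccU1 Nc; rewrite setD1K // => ccE.
rewrite (cardsD1 m S) mS add1n in ltS *.
have sS' : S :\ m \subset S by apply: subsetDl.
by rewrite addnS -addSn -ccE IH // ?(nbcS sS') // (subset_trans sS').
Qed.

Lemma rk_nbc S : nbc E le S -> S \subset E -> rk S = #|S|.
Proof. by move=> nbS sSE; rewrite /rk -{1}(cc_nbc nbS sSE) addKn. Qed.

Lemma rk_cl S : S \subset E -> rk (cl E S) = rk S.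
Proof. by move=> sSE; rewrite /rk (eq_cc (con_cl sSE)). Qed.

Lemma ncnbc_cl X S : X \subset E -> ncnbc_set E le X S -> isNC E (cl E S).
Proof.
move=> sXE /ncnbcP[sSX _ ncS]; apply: cl_NC => //.
  exact: subset_trans sXE.
by move=> e f eS fS ef; case/negP: (ncS e f eS fS).
Qed.

Lemma spanning_cl X S : isNC E X ->
  spanning_ncnbc E le X S = ncnbc_set E le X S && (cl E S == X).
Proof.
move=> ncX; rewrite /spanning_ncnbc; case: (boolP (ncnbc_set _ _ _ _)) => //= cS.
have sSE : S \subset E.
  by case/ncnbcP: cS => sSX _ _; apply: subset_trans (NC_sub ncX).
apply/forallP/eqP => [h|clS x].
  rewrite -[RHS](NC_cl ncX); apply: eq_cl; apply/comp_con => x; exact/eqP.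
by apply/eqP; rewrite -clS; move: x; apply/comp_con => x y; rewrite con_cl.
Qed.

(** [cl E S] is a noncrossing bond inside [X] whose rank is the size of [S], and nested noncrossing
    bonds of equal rank coincide. *)
Lemma card_cl X S : isNC E X -> ncnbc_set E le X S ->
  (#|S| == rk X) = (cl E S == X).
Proof.
move=> ncX cS; have [sSX nbS _] := ncnbcP _ _ cS.
have sXE := NC_sub ncX; have sSE := subset_trans sSX sXE.
rewrite -(rk_nbc nbS sSE) -(rk_cl sSE).
apply/eqP/eqP => [|->//].
exact: (NC_rk_eq sE tE suc (ncnbc_cl sXE cS) ncX (NC_cl_sub sSX ncX)).
Qed.

Lemma ncnbc_add_min X S m : isNC E X -> m \in X ->
  (forall g, g \in X -> pos m <= pos g) ->
  ncnbc_set E le X S -> ncnbc_set E le X (m |: S).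
Proof.
move=> ncX mX min_m /ncnbcP[sSX /nbcP nbS ncS].
have sXE := NC_sub ncX.
have smX : m |: S \subset X by rewrite subUset sub1set mX.
have noX e f : e \in X -> f \in X -> (e == m) || (f == m) -> ~~ crossing e f.
  move=> eX fX efm; apply/negP => /(crossing_smaller sE tE suc ncX eX fX)[g [gX]].
  by case/orP: efm => /eqP->; have := min_m g gX; rewrite leqNgt => /negbTE->.
apply/ncnbcP; split=> //.
  (* The cycle [C] lies wholly in [X], since [X] is closed. If [m] were in the broken circuit, then
     [m] and the least edge [e] would precede each other and be equal; hence the broken circuit
     already lies in [S]. *)
  apply/nbcP => C e cC eC min_e; apply/negP => sCm.
  have sCX := subset_trans sCm smX.
  have eE := subsetP (cycle_sub cC) _ eC.
  have eX : e \in X by apply: (NC_mem ncX eE); apply: conS sCX (cycle_con cC eC).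
  have /negP := nbS C e cC eC min_e; apply; apply/subsetP => f fC.
  have /setU1P[fm|//] := subsetP sCm f fC.
  move: fC; rewrite fm in_setD1 => /andP[/negP Nme mC]; case: Nme; apply/eqP.
  apply: (pos_inj tE) => //; first exact: (subsetP sXE).
  by apply/eqP; rewrite eqn_leq min_m // min_e.
move=> e f eS fS; have eX := subsetP smX _ eS; have fX := subsetP smX _ fS.
have [efm|] := boolP ((e == m) || (f == m)); first exact: noX.
move=> /norP[Nem Nfm]; apply: ncS; first by move: eS; rewrite !inE (negbTE Nem).
by move: fS; rewrite !inE (negbTE Nfm).
Qed.

Lemma labels_rcons X Y s :
  labels le X (rcons s Y) = rcons (labels le X s) (mlab le (last X s) Y).
Proof. by rewrite /labels -!cats1 pairmap_cat. Qed.

Lemma labelset_rcons (l : seq (option (edge n))) m :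
  labelset (rcons l (Some m)) = m |: labelset l.
Proof. by apply/setP => e; rewrite !inE mem_rcons inE. Qed.

Lemma decreasing_rcons (l : seq (option (edge n))) (a : option (edge n)) :
  decreasing le (rcons l a) = decreasing le l && ((l == [::]) || lt_lab le a (last None l)).
Proof. by rewrite /decreasing; case: l => //= b l; rewrite rcons_path. Qed.

(** The second conjunct carries the induction: the last label precedes every edge of the current
    bond, so a still smaller next label is the least edge of the next bond and [ncnbc_add_min]
    applies. For the empty chain it is vacuous. *)
Lemma decreasing_chain s : path (covers E) set0 s -> decreasing le (labels le set0 s) ->
  spanning_ncnbc E le (last set0 s) (labelset (labels le set0 s)) /\
  forall g, g \in last set0 s ->
    exists m, [/\ m \in E, last None (labels le set0 s) = Some m & pos m <= pos g].
Proof.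
elim/last_ind: s => [|s X IH] /=.
  move=> _ _; split; last by move=> g; rewrite inE.
  have -> : labelset ([::] : seq (option (edge n))) = set0 by apply/setP => e; rewrite !inE.
  rewrite spanning_cl ?NC0 // NC_cl ?NC0 // eqxx andbT; apply/ncnbcP.
  split=> //; last by move=> e f; rewrite inE.
  apply/nbcP => C e cC eC _; apply/negP => sC0; have := cycle_con cC eC.
  move/(conS sC0)/con0 => e12; have := sE (subsetP (cycle_sub cC) _ eC).
  by rewrite e12 ltnn.
rewrite rcons_path last_rcons => /andP[ps cov].
have [m [lm mX NmZ min_m XE]] := covers_min sE tE suc cov.
set Z := last set0 s in IH cov lm NmZ min_m XE *.
have [ncZ ncX] := covers_NC cov.
have mE := subsetP (NC_sub ncX) _ mX.
rewrite labels_rcons -/Z lm decreasing_rcons labelset_rcons last_rcons.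
case/andP=> decs lts; have [spS minZ] := IH ps decs.
have min_X g : g \in X -> pos m <= pos g.
  move=> gX; have [gZ|NgZ] := boolP (g \in Z); last by apply: min_m; rewrite inE NgZ.
  have [m' [m'E lE le_g]] := minZ g gZ.
  apply: leq_trans le_g; apply: ltnW; rewrite -(pos_lt tE) //.
  by move: lts; rewrite lE; case: (labels le set0 s) lE.
split; last by move=> g /min_X; exists m.
move: spS; rewrite !spanning_cl // => /andP[cS /eqP clS].
have sZX : Z \subset X by case/and4P: cov => _ _ /proper_sub.
have sSZ : labelset (labels le set0 s) \subset Z by case/ncnbcP: cS.
apply/andP; split.
  apply: ncnbc_add_min => //; apply: ncnbcS cS => //; exact: subset_trans sZX.
rewrite XE; apply/eqP; apply: eq_cl => x y.
by rewrite !conU1 -clS !con_cl // (subset_trans sSZ) // NC_sub.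
Qed.

(** The least edge [m] of [S] must be the last label: recurse on [S :\ m], which spans its own
    closure [Z], and finish with the cover from [Z] to [X]. *)
Lemma decreasing_chain_exists X S : isNC E X -> spanning_ncnbc E le X S ->
  exists s, [/\ sat_chain E set0 X s, decreasing le (labels le set0 s) &
    labelset (labels le set0 s) = S].
Proof.
have [k] := ubnP #|S|; elim: k S X => // k IH S X ltS ncX.
rewrite spanning_cl // => /andP[cS /eqP clSX].
have [sSX nbS ncS] := ncnbcP _ _ cS; have sXE := NC_sub ncX.
have sSE := subset_trans sSX sXE.
have [S0|/set_min[m mS min_m]] := eqVneq S set0.
  exists [::]; split=> //.
  by rewrite /sat_chain /= -clSX S0 (NC_cl (NC0 sE)).
have mX := subsetP sSX _ mS; have mE := subsetP sXE _ mX.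
pose S' := S :\ m; have sS' : S' \subset S by apply: subsetDl.
have sS'E := subset_trans sS' sSE.
pose Z := cl E S'.
have cS' : ncnbc_set E le Z S' by apply: ncnbcS cS; rewrite // sub_cl.
have ncZ : isNC E Z by apply: ncnbc_cl cS'; apply: cl_sub.
have ltS' : #|S'| < k by move: ltS; rewrite (cardsD1 m) mS add1n ltnS.
have [|s [/andP[ps /eqP ls] decs lsS]] := IH S' Z ltS' ncZ.
  by rewrite spanning_cl // cS' eqxx.
have NmZ : m \notin Z.
  by rewrite inE mE; apply: nbc_rem.
(* The least edge of [S] is least in all of [X]: an earlier edge of [X] would have its ends joined
   by later edges of [S], which [nbc_con] forbids. *)
have min_X g : g \in X -> pos m <= pos g.
  rewrite leqNgt -clSX inE => /andP[gE cg]; apply: contraL cg => ltg.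
  apply: (nbc_con nbS) => // f /min_m; exact: leq_trans.
have sZX : Z \subset X by rewrite -clSX; apply: clS.
have mlabZX : mlab le Z X = Some m.
  by apply: (mlab_eq tE) => // g; rewrite inE => /andP[_ /min_X].
have XE : X = cl E (m |: Z).
  rewrite -clSX -(setD1K mS) -/S'; apply: eq_cl => x y.
  by rewrite !conU1 !con_cl.
exists (rcons s X); split.
- rewrite /sat_chain rcons_path ps last_rcons eqxx andbT /= ls XE.
  by apply: covers_merge; rewrite -?XE.
- rewrite labels_rcons decreasing_rcons decs ls mlabZX /=.
  case/lastP: (labels le set0 s) lsS (label_some sE tE suc ps) => [|l [e|]] //;
    last by rewrite mem_rcons inE.
  rewrite last_rcons => lsS _; apply/orP; right.
  have : e \in S' by rewrite -lsS labelset_rcons setU11.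
  rewrite in_setD1 => /andP[Nem eS]; rewrite (pos_lt tE) ?(subsetP sSE) //.
  rewrite ltn_neqAle min_m // andbT.
  by apply: contraNneq Nem => /(pos_inj tE) -> //; apply: (subsetP sSE).
- by rewrite labels_rcons ls mlabZX labelset_rcons lsS setD1K.
Qed.

End BrokenCircuits.
Arguments ncnbcP {n E le X S}.

(** * The Möbius function and the characteristic polynomial *)

Section Moebius.
Variables (n : nat) (E : {set edge n}) (le : rel (edge n)).
Hypotheses (sE : simple_graph E) (tE : total_order_on E le)
  (suc : strongly_upper_crossed E le).
Implicit Types (X Y Z S C : {set edge n}) (e f g m : edge n).
Implicit Types s : seq {set edge n}.

Local Notation pos := (pos E le).

Lemma mem_labelE s a : path (covers E) set0 s -> a \in labels le set0 s ->
  if a is Some e then e \in E else false.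
Proof.
move=> ps; case: a => [e|]; last by rewrite (negbTE (label_some sE tE suc ps)).
move/(label_mem sE tE suc (NC0 sE) ps) => /andP[+ _].
by have [/NC_sub/subsetP + _] := path_covers (NC0 sE) ps; apply.
Qed.

(** A strictly decreasing sequence is determined by its set of entries, and a chain by its sequence
    of labels. *)
Lemma decreasing_chain_unique s s' :
  path (covers E) set0 s -> path (covers E) set0 s' ->
  decreasing le (labels le set0 s) -> decreasing le (labels le set0 s') ->
  labelset (labels le set0 s) = labelset (labels le set0 s') -> s = s'.
Proof.
move=> ps ps' decs decs' /setP lE; apply: (labels_inj sE tE suc ps ps').
apply: irr_sorted_eq_in decs decs' _ => [b a c|a|a].
- move=> /(mem_labelE ps) bE /(mem_labelE ps) aE /(mem_labelE ps) cE ab bc.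
  exact: (lt_lab_trans_in tE bE cE aE) bc ab.
- by move=> _; case: a => //= e; rewrite /lt_of eqxx andbF.
case: a => [e|]; first by have := lE e; rewrite !inE.
by rewrite (negbTE (label_some sE tE suc ps)) (negbTE (label_some sE tE suc ps')).
Qed.

Local Open Scope ring_scope.

(** Each set is counted at its closure [Y], where spanning amounts to having size [rk Y]. The weight
    [F] is left free so that the Möbius function and the characteristic polynomial can share the
    regrouping. *)
Lemma sum_by_closure (R : nmodType) (F : nat -> R) X : isNC E X ->
  \sum_(Y : {set edge n} | isNC E Y && (Y \subset X)) F (rk Y) *+ ncnbc E le (rk Y) Y =
  \sum_(S : {set edge n} | ncnbc_set E le X S) F #|S|.
Proof.
move=> ncX.
rewrite [RHS](partition_big (cl E) (fun Y => isNC E Y && (Y \subset X))) /=; last first.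
  move=> S cS; rewrite (ncnbc_cl sE (NC_sub ncX) cS) /=.
  by case/ncnbcP: cS => sSX _ _; apply: NC_cl_sub.
apply: eq_bigr => Y /andP[ncY sYX].
transitivity (\sum_(S : {set edge n} | ncnbc_set E le Y S && (#|S| == rk Y)) F #|S|).
  rewrite (eq_bigr (fun=> F (rk Y))) => [|S /andP[_ /eqP->//]].
  by rewrite sumr_const /ncnbc cardsE.
apply: eq_bigl => S; apply/andP/andP => -[cS].
  rewrite (card_cl sE tE suc ncY cS) => ->; split=> //.
  have [sSY _ _] := ncnbcP cS.
  exact: (ncnbcS tE (subxx S) (subset_trans sSY sYX) cS).
move=> /eqP clSY.
have [sSX _ _] := ncnbcP cS.
have cSY : ncnbc_set E le Y S.
  apply: (ncnbcS tE (subxx S) _ cS); rewrite -clSY sub_cl //.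
  exact: subset_trans (NC_sub ncX).
by rewrite cSY (card_cl sE tE suc ncY) ?clSY.
Qed.

Lemma alternating_sum X : isNC E X -> X != set0 ->
  \sum_(S : {set edge n} | ncnbc_set E le X S) (-1) ^+ #|S| = 0 :> int.
Proof.
move=> ncX /(set_min E le)[m mX min_m].
rewrite (bigID (fun S => m \in S)) /=.
(* Sets containing [m] are written as [m |: S] with [S] avoiding [m]; the two halves then cancel
   term by term. *)
rewrite (reindex_onto (fun S => m |: S) (fun S => S :\ m)) /=; last first.
  by move=> S /andP[_ mS]; rewrite setD1K.
rewrite (eq_bigl (fun S => ncnbc_set E le X S && (m \notin S))); last first.
  move=> S; rewrite setU11 andbT; apply/andP/andP => -[h1 h2].
    have NmS : m \notin S by rewrite -(eqP h2) setD11.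
    split=> //; apply: (ncnbcS tE _ _ h1); first exact: subsetUr.
    by case/ncnbcP: h1 => + _ _; apply/subset_trans/subsetUr.
  by rewrite setU1K // eqxx; split=> //; apply: ncnbc_add_min.
rewrite -big_split big1 //= => S /andP[_ NmS].
by rewrite cardsU1 NmS exprS mulN1r addNr.
Qed.

Lemma ncnbc0 : ncnbc E le 0 set0 = 1%N.
Proof.
rewrite /ncnbc -(cards1 (set0 : {set edge n})); congr #|pred_of_set _|.
apply/setP => S; rewrite !inE cards_eq0 andb_idl // => /eqP->.
have [] := decreasing_chain sE tE suc (s := [::]) isT isT.
rewrite spanning_cl ?NC0 // => /andP[cS _] _.
by apply: (ncnbcS tE _ _ cS); apply: sub0set.
Qed.

(** Isolating the term of [X] itself in the alternating sum yields the recursion of the Möbius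
    function. Proper subsets are strictly smaller, so fuel bounding the size of [X] suffices. *)
Lemma mob_auxE k X : (#|X| <= k)%N -> isNC E X ->
  mob_aux E k X = (-1) ^+ rk X * (ncnbc E le (rk X) X)%:R.
Proof.
have base : 1 = (-1) ^+ rk (set0 : {set edge n}) * (ncnbc E le (rk (set0 : {set edge n})) set0)%:R :> int.
  by rewrite rk0 ncnbc0.
elim: k X => [|k IH] X /=.
  by rewrite leqn0 cards_eq0 => /eqP->.
move=> leX ncX; have [->//|NX0] := eqVneq X set0.
have := alternating_sum ncX NX0; rewrite -sum_by_closure //.
rewrite (bigD1 X) ?ncX ?subxx //= mulr_natr addrC => /eqP; rewrite addr_eq0 => /eqP h.
rewrite -[RHS]opprK -h; congr (- _).
rewrite (eq_bigl (fun Y => (isNC E Y && (Y \subset X)) && (Y != X))); last first.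
  by move=> Y; rewrite properEneq andbA andbAC.
apply: eq_bigr => Y /andP[/andP[ncY sYX] NYX]; rewrite -mulr_natr IH //.
by rewrite -ltnS (leq_trans _ leX) // proper_card // properEneq NYX.
Qed.

Lemma mobiusE X : isNC E X -> mobius E X = (-1) ^+ rk X * (ncnbc E le (rk X) X)%:R.
Proof. exact: mob_auxE. Qed.

Lemma chi_atE (R : fieldType) (t : R) :
  chi_at E t = \sum_(k < #|E|.+1)
    (-1) ^+ k * (ncnbc E le k E)%:R * t ^ ((rhoP E)%:Z - k%:Z).
Proof.
have ncE := NC_E sE suc.
(* An NBC set has rank equal to its size. Hence the natural-number subtraction below never
   truncates, and the terms of the target sum with [k] above the rank vanish. *)
have card_leq S : ncnbc_set E le E S -> (#|S| <= rhoP E)%N.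
  case/ncnbcP => sSE nbS _.
  by rewrite (rhoP_E sE suc) -(rk_nbc sE tE nbS sSE) leq_rk.
transitivity (\sum_(S : {set edge n} | ncnbc_set E le E S)
    (-1) ^+ #|S| * t ^+ (rhoP E - #|S|)).
  rewrite -(@sum_by_closure _ (fun k => (-1) ^+ k * t ^+ (rhoP E - k))) //.
  rewrite /chi_at; apply: eq_big => [X|X ncX].
    by case: (boolP (isNC E X)) => // /NC_sub ->.
  by rewrite mobiusE // rmorphM rmorphXn rmorphN1 rmorph_nat /= mulrAC mulr_natr.
rewrite (partition_big (fun S => inord #|S| : 'I_#|E|.+1) predT) //=.
apply: eq_bigr => k _.
pose c := (-1) ^+ k * t ^ ((rhoP E)%:Z - k%:Z).
rewrite (eq_bigr (fun=> c)) => [|S /andP[cS /eqP kE]]; last first.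
  have [sSE _ _] := ncnbcP cS.
  rewrite /c; have <- : #|S| = k by rewrite -kE inordK // ltnS subset_leq_card.
  by rewrite subzn // card_leq.
rewrite sumr_const mulrAC mulr_natr; congr (_ *+ _).
rewrite /ncnbc cardsE; apply: eq_card => S; rewrite !unfold_in.
apply: andb_id2l => cS; have [sSE _ _] := ncnbcP cS.
by rewrite -(inj_eq val_inj) /= inordK // ltnS subset_leq_card.
Qed.

End Moebius.

(** * Lexicographic shelling of the order complex *)

Section Shelling.

Lemma descent (h : nat -> nat) a b : a < b -> h b < h a ->
  exists2 e, a < e <= b & h e < h e.-1.
Proof.
elim: b => // b IH; rewrite ltnS => leab ltba.
have [lth|geh] := ltnP (h b.+1) (h b); first by exists b.+1; rewrite ?leqnn ?ltnS ?leab.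
move: leab; rewrite leq_eqVlt => /orP[/eqP ab|ltab].
  by move: ltba; rewrite ab ltnNge geh.
have [e /andP[ae eb] he] := IH ltab (leq_ltn_trans geh ltba).
by exists e; rewrite // ae ltnW.
Qed.

Lemma lexi_lt_nth (s t : seqlexi nat) i : size s = size t -> i < size s ->
  (forall j, j < i -> nth 0 s j = nth 0 t j) -> nth 0 s i < nth 0 t i ->
  (s < t)%O.
Proof.
elim: s t i => [|x s IH] [|y t] i //= [st] + eqh.
rewrite ltxi_cons.
case: i eqh => [_ _ /= xy|i eqh]; first by rewrite leEnat ltnW //= leqNgt xy.
rewrite ltnS /= => lti ltst; have /= -> := eqh 0 isT.
by rewrite lexx /= (IH t i) // => j ltj; apply: (eqh j.+1).
Qed.

Variables (n : nat) (E : {set edge n}) (le : rel (edge n)).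
Hypotheses (sE : simple_graph E) (tE : total_order_on E le)
  (suc : strongly_upper_crossed E le).
Implicit Types (X Y Z W : {set edge n}) (F : {set {set edge n}}).

Local Notation pos := (pos E le).
Local Notation mer m X := (cl E (m |: X)).
Local Notation face := (order_complex E).
Local Notation facet := (is_facet face).

Lemma faceP F : reflect ((forall X, X \in F -> isNC E X) /\
    (forall X Y, X \in F -> Y \in F -> X \subset Y \/ Y \subset X)) (face F).
Proof.
apply: (iffP andP) => -[ncF cF]; split; first exact/forall_inP.
- by move=> X Y XF YF; apply/orP; move/forall_inP/(_ X XF)/forall_inP/(_ Y YF): cF.
- exact/forall_inP.
- by apply/forall_inP => X XF; apply/forall_inP => Y YF; apply/orP/cF.
Qed.

Lemma face_sub F X Y : face F -> X \in F -> Y \in F -> rk X <= rk Y -> X \subset Y.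
Proof.
case/faceP=> ncF cF XF YF le_rk; have [//|sYX] := cF X Y XF YF.
by rewrite (NC_rk_eq sE tE suc (ncF Y YF) (ncF X XF) sYX) //; have := leq_rk sYX; lia.
Qed.

Lemma face_rk_inj F X Y : face F -> X \in F -> Y \in F -> rk X = rk Y -> X = Y.
Proof.
move=> fF XF YF rXY; apply/eqP; rewrite eqEsubset.
by rewrite !(face_sub fF) // rXY.
Qed.

Lemma faceU1 F Z : face F -> isNC E Z ->
  (forall X, X \in F -> X \subset Z \/ Z \subset X) -> face (Z |: F).
Proof.
case/faceP=> ncF cF ncZ cZ; apply/faceP; split.
  by move=> X /setU1P[->|/ncF].
move=> X Y /setU1P[->|XF] /setU1P[->|YF]; first by left.
- by case: (cZ Y YF); [right | left].
- exact: cZ.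
- exact: cF.
Qed.

Lemma facet_face F : facet F -> face F.
Proof. by case/andP. Qed.

Lemma facet_mem F Z : facet F -> isNC E Z ->
  (forall X, X \in F -> X \subset Z \/ Z \subset X) -> Z \in F.
Proof.
case/andP=> fF /forallP/(_ (Z |: F)); rewrite subsetUr andbT => maxF ncZ cZ.
by move/implyP/(_ (faceU1 fF ncZ cZ))/eqP: maxF => <-; apply: setU11.
Qed.

Lemma facet_E F : facet F -> E \in F.
Proof.
move=> fF; apply: facet_mem (NC_E sE suc) _ => // X.
by case/faceP: (facet_face fF) => ncF _ /ncF/NC_sub; left.
Qed.

(** Purity of the complex. Let [X] be the member of rank [i] and [Y] the lowest member above it; the
    greedy merge of [X] towards [Y] is comparable with every member, so maximality puts it in
    [F]. *)
Lemma facet_level F i : facet F -> i <= rk E -> exists2 X, X \in F & rk X = i.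
Proof.
move=> fF; have /faceP[ncF cF] := facet_face fF.
elim: i => [_|i IH lti].
  exists set0; last exact: rk0.
  by apply: facet_mem (NC0 sE) _ => // X _; right; apply: sub0set.
have [X XF rX] := IH (ltnW lti).
pose P W := (W \in F) && (i < rk W).
have PE : P E by rewrite /P facet_E.
case: (arg_minnP (@rk n) PE) => Y /andP[YF ltY] minY.
have sXY : X \subset Y by apply: (face_sub (facet_face fF)); rewrite // rX ltnW.
have pXY : X \proper Y.
  by rewrite properEneq sXY andbT; apply: contraTneq ltY => <-; rewrite rX ltnn.
have [m [_ _ _ cXZ sZY]] := greedy_cover sE tE suc (ncF X XF) (ncF Y YF) pXY.
have rZ := covers_rk sE tE suc cXZ; have [_ ncZ] := covers_NC cXZ.
exists (mer m X); last by rewrite rZ rX.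
apply: facet_mem => // W WF; have [leW|ltW] := leqP (rk W) i.
  left; apply: subset_trans (_ : X \subset _).
    by apply: (face_sub (facet_face fF)); rewrite // rX.
  by case/and4P: cXZ => _ _ /proper_sub.
right; apply: subset_trans sZY _.
by apply: (face_sub (facet_face fF)) => //; apply: minY; rewrite /P WF.
Qed.

(** Any further member of a larger face would share its rank with a member of [F], and members of a
    face with the same rank coincide. *)
Lemma facet_of_levels F : face F ->
  (forall i, i <= rk E -> exists2 X, X \in F & rk X = i) -> facet F.
Proof.
move=> fF levF; rewrite /is_facet fF; apply/forall_inP => F' /andP[fF' sFF'].
rewrite eqEsubset sFF' andbT; apply/subsetP => X XF'.
have ncX : isNC E X by case/faceP: fF' => + _; apply.
have [Y YF rY] := levF _ (leq_rk (NC_sub ncX)).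
by rewrite -(face_rk_inj fF' (subsetP sFF' _ YF) XF' rY).
Qed.

(** For a facet, each rank up to [rk E] has exactly one member, so the choice is forced and the
    default [set0] is not reached there. *)
Definition lvl F i : {set edge n} := odflt set0 [pick X in F | rk X == i].

Lemma lvl_rk F X : face F -> X \in F -> lvl F (rk X) = X.
Proof.
move=> fF XF; rewrite /lvl; case: pickP => [Y /andP[YF /eqP rY]|/(_ X)].
  exact: face_rk_inj fF YF XF rY.
by rewrite XF eqxx.
Qed.

Lemma facet_lvl F i : facet F -> i <= rk E -> lvl F i \in F /\ rk (lvl F i) = i.
Proof.
by move=> fF /(facet_level fF)[X XF <-]; rewrite lvl_rk ?facet_face.
Qed.

Lemma lvl_sub F i j : facet F -> i <= j -> j <= rk E -> lvl F i \subset lvl F j.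
Proof.
move=> fF leij lej; have [iF ri] := facet_lvl fF (leq_trans leij lej).
by have [jF rj] := facet_lvl fF lej; apply: face_sub (facet_face fF) iF jF _; rewrite ri rj.
Qed.

Lemma lvl_NC F i : facet F -> i <= rk E -> isNC E (lvl F i).
Proof.
move=> fF /(facet_lvl fF)[iF _].
by case/faceP: (facet_face fF) => + _; apply.
Qed.

Lemma lvl_covers F i : facet F -> i < rk E -> covers E (lvl F i) (lvl F i.+1).
Proof.
move=> fF lti; apply: (rk_covers sE tE suc); rewrite ?lvl_NC ?lvl_sub // 1?ltnW //.
by rewrite !(facet_lvl fF _).2 // ltnW.
Qed.

Lemma facet_lvl_inj F F' : facet F -> facet F' ->
  (forall i, i <= rk E -> lvl F i = lvl F' i) -> F = F'.
Proof.
have sub G G' : facet G -> facet G' ->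
    (forall i, i <= rk E -> lvl G i = lvl G' i) -> G \subset G'.
  move=> fG fG' h; apply/subsetP => X XG.
  have leX : rk X <= rk E.
    by apply/leq_rk/NC_sub; case/faceP: (facet_face fG) => + _; apply.
  by rewrite -(lvl_rk (facet_face fG) XG) h // (facet_lvl fG' _).1.
move=> fF fF' h; apply/eqP; rewrite eqEsubset !sub // => i /h //.
Qed.

(** Labels are recorded as positions, so that facets can be compared by lexicographic order on
    sequences of numbers. For a facet and [i < rk E] the default 0 is not reached, by
    [lvl_covers]. *)
Definition lab F i : nat :=
  if mlab le (lvl F i) (lvl F i.+1) is Some m then pos m else 0.

Definition key F : seqlexi nat := mkseq (lab F) (rk E).

Lemma key_lt F F' d : d < rk E -> (forall i, i < d -> lab F i = lab F' i) ->
  lab F d < lab F' d -> (key F < key F')%O.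
Proof.
move=> ltd eqd ltF; apply: (lexi_lt_nth (i := d)); rewrite ?size_mkseq //.
  by move=> j ltj; rewrite !nth_mkseq ?eqd // (ltn_trans ltj).
by rewrite !nth_mkseq.
Qed.

(** Take [d] just below the first rank where the facets part. Their labels agree before [d], and
    differ at [d] because a label determines its cover; the order of the keys then decides which is
    smaller. *)
Lemma first_difference F F' : facet F -> facet F' -> F != F' ->
  (key F <= key F')%O ->
  exists d, [/\ d < rk E, lvl F d = lvl F' d, lvl F d.+1 != lvl F' d.+1 &
    lab F d < lab F' d].
Proof.
move=> fF fF' NFF' leF.
have exk : exists k, (k <= rk E) && (lvl F k != lvl F' k).
  have [/existsP[k neq]|/existsPn eqs] :=
    boolP [exists k : 'I_(rk E).+1, lvl F k != lvl F' k].
    by exists k; rewrite -ltnS ltn_ord.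
  case/eqP: NFF'; apply: facet_lvl_inj => // i lei.
  by have := eqs (Ordinal (lei : i < (rk E).+1)); rewrite negbK => /eqP.
case: (ex_minnP exk) => -[|d] /andP[ltd neq] mind.
  have lvl0 G : facet G -> lvl G 0 = set0.
    move=> fG; apply/esym/(NC_rk_eq sE tE suc (NC0 sE)); rewrite ?lvl_NC ?sub0set //.
    by rewrite rk0 (facet_lvl fG _).2.
  by rewrite !lvl0 ?eqxx in neq.
have eqd i : i <= d -> lvl F i = lvl F' i.
  move=> lei; apply/eqP; apply: contraT => neqi.
  have := mind i; rewrite neqi (leq_trans lei (ltnW ltd)) => /(_ isT).
  by rewrite ltnNge lei.
exists d; split=> //; first exact: eqd.
have cF := lvl_covers fF ltd; have cF' := lvl_covers fF' ltd.
have labd i : i < d -> lab F i = lab F' i.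
  by move=> lti; rewrite /lab !eqd // ltnW.
rewrite ltnNge leq_eqVlt negb_or -leqNgt; apply/andP; split.
  apply: contra_neqN neq => /eqP; rewrite /lab.
  rewrite (eqd d) // in cF *.
  have [m [lm mY _ _ YE]] := covers_min sE tE suc cF.
  have [m' [lm' m'Y _ _ Y'E]] := covers_min sE tE suc cF'.
  rewrite lm lm' => /(pos_inj tE) mm'; rewrite YE Y'E -mm' //.
    by case/covers_NC: cF' => _ /NC_sub/subsetP; apply.
  by case/covers_NC: cF => _ /NC_sub/subsetP; apply.
rewrite leqNgt; apply/negP => ltl.
by have := key_lt ltd (fun i h => esym (labd i h)) ltl; rewrite ltNge leF.
Qed.

(** Within the interval of rank two around the descent, replace the middle bond by the greedy one.
    Its label is at most the upper label of [F], hence smaller than the lower one, so the key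
    drops. *)
Lemma exchange F e : facet F -> 0 < e < rk E -> lab F e < lab F e.-1 ->
  exists F', [/\ facet F', (key F' < key F)%O & F' :&: F = F :\ lvl F e].
Proof.
(* The index shifts here: the replaced bond [B] now has rank [e.+1], between [A] of rank [e] and [C]
   of rank [e.+2]. *)
case: e => // e fF /andP[_ lte] /= desc.
have lte1 := ltnW lte.
set A := lvl F e in desc *; set B := lvl F e.+1 in desc *; set C := lvl F e.+2 in desc *.
have cAB : covers E A B := lvl_covers fF lte1.
have cBC : covers E B C := lvl_covers fF lte.
have [ncA ncB] := covers_NC cAB; have [_ ncC] := covers_NC cBC.
have [m1 [l1 m1B Nm1A _ BE]] := covers_min sE tE suc cAB.
have [m2 [l2 m2C Nm2B _ _]] := covers_min sE tE suc cBC.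
move: desc; rewrite /lab -/A -/B -/C l1 l2 => desc.
have pAB : A \proper B by case/and4P: cAB.
have pAC : A \proper C by apply: proper_trans pAB _; case/and4P: cBC.
have [m [mC NmA min_m cAZ sZC]] := greedy_cover sE tE suc ncA ncC pAC.
have lZ := mlab_merge tE (NC_sub ncC) mC NmA (proper_sub pAC) min_m sZC.
set Z := mer m A in cAZ sZC lZ.
have [_ ncZ] := covers_NC cAZ.
have ltm : pos m < pos m1.
  apply: leq_ltn_trans desc; apply: min_m; rewrite inE m2C andbT.
  by apply: contra Nm2B; apply/subsetP/proper_sub.
have [[AF rA] [BF rB]] : (A \in F /\ rk A = e) /\ (B \in F /\ rk B = e.+1).
  by split; apply: facet_lvl; rewrite // ltnW // ltnW.
have [CF rC] : C \in F /\ rk C = e.+2 by apply: facet_lvl.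
have rZ : rk Z = e.+1 by rewrite (covers_rk sE tE suc cAZ) rA.
have NZB : Z != B.
  apply: contraTneq ltm => ZB; move: l1; rewrite -ZB lZ => -[->].
  by rewrite ltnn.
have NZF : Z \notin F.
  apply: contraNN NZB => ZF; apply/eqP.
  by apply: face_rk_inj (facet_face fF) ZF BF _; rewrite rZ rB.
have fF' : face (Z |: (F :\ B)).
  apply: faceU1 => //.
    have /faceP[ncF cF] := facet_face fF; apply/faceP; split.
      by move=> X /setD1P[_ /ncF].
    by move=> X Y /setD1P[_ XF] /setD1P[_ YF]; apply: cF.
  move=> X /setD1P[NXB XF]; have sub := face_sub (facet_face fF).
  have NrX : rk X != e.+1.
    by apply: contraNneq NXB => rX; apply/eqP/(face_rk_inj (facet_face fF)); rewrite // rX.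
  (* Members of rank below that of [B] lie under [A], those above it lie over [C], and [Z] sits
     between [A] and [C]. *)
  have [ltX|ltX|rX] := ltngtP (rk X) e.+1; last by rewrite rX eqxx in NrX.
    left; apply: subset_trans (_ : A \subset Z); first by apply: sub; rewrite // rA.
    by case/and4P: cAZ => _ _ /proper_sub.
  by right; apply: subset_trans sZC _; apply: sub; rewrite // rC.
set F' := Z |: (F :\ B) in fF'.
have lvlF' i : i <= rk E -> i != e.+1 -> lvl F i \in F' /\ lvl F' i = lvl F i.
  move=> lei Nie; have [iF ri] := facet_lvl fF lei.
  have iF' : lvl F i \in F'.
    rewrite in_setU1 in_setD1 iF andbT; apply/orP; right.
    by apply: contraNneq Nie => iB; rewrite -ri iB rB.
  by split=> //; rewrite -{1}ri lvl_rk.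
have lvlZ : lvl F' e.+1 = Z by rewrite -rZ lvl_rk ?setU11.
have facF' : facet F'.
  apply: facet_of_levels => // i lei; have [->|Nie] := eqVneq i e.+1.
    by exists Z; rewrite ?setU11.
  by have [iF' _] := lvlF' i lei Nie; exists (lvl F i) => //; apply: (facet_lvl fF lei).2.
exists F'; split=> //.
  apply: (key_lt (d := e)); first exact: ltnW.
    move=> i lti; rewrite /lab.
    have lei : i.+1 <= rk E by apply: leq_trans lti (ltnW (ltnW lte)).
    have Ni : i != e.+1 by rewrite neq_ltn ltnS (ltnW lti).
    have Ni1 : i.+1 != e.+1 by rewrite neq_ltn ltnS lti.
    by rewrite (lvlF' i (ltnW lei) Ni).2 (lvlF' i.+1 lei Ni1).2.
  have Ne : e != e.+1 by rewrite neq_ltn ltnSn.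
  have Aeq : lvl F' e = A := (lvlF' e (ltnW (ltnW lte)) Ne).2.
  by rewrite /lab Aeq lvlZ lZ -/A -/B l1.
apply/setP => X; rewrite !inE andb_orl andbAC -andbA andbb andbC.
by case: eqVneq => [->|]; rewrite ?(negbTE NZF) ?andbF ?orbF //.
Qed.

Lemma NC_shellable : shellable face.
Proof.
pose keyle F F' := (key F <= key F')%O.
pose L := sort keyle (enum facet).
have LP F : (F \in L) = facet F by rewrite mem_sort mem_enum.
have uL : uniq L by rewrite sort_uniq enum_uniq.
have key_total : total keyle by move=> F F'; apply: le_total.
have key_trans : transitive keyle by move=> F F' F''; apply: le_trans.
have sL : sorted keyle L by apply: sort_sorted.
exists L; split=> // i j /andP[ltij ltj].
have lti := ltn_trans ltij ltj.
set Fi := nth set0 L i; set Fj := nth set0 L j.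
have fFi : facet Fi by rewrite -LP mem_nth.
have fFj : facet Fj by rewrite -LP mem_nth.
have NFij : Fi != Fj by rewrite nth_uniq // neq_ltn ltij.
have leij : (key Fi <= key Fj)%O.
  by apply: (sorted_leq_nth key_trans _ set0 sL); rewrite ?inE ?(ltnW ltij) // => F; apply: lexx.
have [d [ltd eqd _ ltlab]] := first_difference fFi fFj NFij leij.
have cov := lvl_covers fFi ltd.
have [m [lm mY NmX _ _]] := covers_min sE tE suc cov.
have mE : m \in E by case/covers_NC: cov => _ /NC_sub/subsetP; apply.
have labFi : lab Fi d = pos m by rewrite /lab lm.
have ext : exists t, (t <= rk E) && (m \in lvl Fj t).
  by exists (rk E); rewrite leqnn (lvl_rk (facet_face fFj)) ?facet_E.
(* [t] is the first rank at which the later facet contains [m], the edge that the earlier facet adds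
   at rank [d]. *)
case: (ex_minnP ext) => t /andP[let_ mt] mint.
have ltdt : d < t.
  rewrite ltnNge; apply: contra NmX => letd; rewrite eqd.
  by apply: subsetP mt; apply: lvl_sub => //; apply: ltnW.
have below e : e < t -> m \notin lvl Fj e.
  move=> lte; apply/negP => me; have := mint e; rewrite me andbT.
  by rewrite (leq_trans (ltnW lte)) // => /(_ isT); rewrite leqNgt lte.
(* After this shift [m] enters [Fj] in the step from [t] to [t.+1], so the label of that step is at
   most [m]. *)
case: t let_ mt mint ltdt below {ext} => // t let_ mt mint; rewrite ltnS => ledt below.
have labt : lab Fj t <= pos m.
  have [w [lw _ _ min_w _]] := covers_min sE tE suc (lvl_covers fFj let_).
  by rewrite /lab lw; apply: min_w; rewrite inE mt below.
have ltdt : d < t.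
  rewrite ltn_neqAle ledt andbT; apply: contraTneq labt => <-.
  by rewrite -ltnNge -labFi.
(* The label of [Fj] exceeds [m] at [d] and is at most [m] at [t], so a descent occurs in
   between. *)
have [|e /andP[lde let2] desc] := @descent (lab Fj) d t ltdt.
  by apply: leq_ltn_trans labt _; rewrite -labFi.
have lteE : e < rk E by apply: leq_ltn_trans let2 _.
have [|F' [fF' ltF' capF']] := exchange fFj _ desc.
  by rewrite lteE (leq_ltn_trans _ lde).
have F'L : F' \in L by rewrite LP.
exists (index F' L).
  rewrite ltnNge; apply/negP => lej.
  have := sorted_leq_nth key_trans (fun F => lexx _) set0 sL j (index F' L).
  rewrite !inE ltj index_mem F'L => /(_ isT isT lej).
  by rewrite nth_index // /keyle leNgt ltF'.
exists (lvl Fj e); first by case: (facet_lvl fFj (ltnW lteE)).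
rewrite nth_index //; split=> //.
(* At rank [e] the facet [Fi] already contains [m] and [Fj] does not yet, so the exchanged bond is
   not common to both. *)
apply/subsetP => X /setIP[XFi XFj]; rewrite in_setD1 XFj andbT.
apply: contraTneq (below e let2) => XE.
have [_ re] := facet_lvl fFj (ltnW lteE).
rewrite negbK -XE -(lvl_rk (facet_face fFi) XFi) XE re.
exact: (subsetP (lvl_sub fFi lde (ltnW lteE)) _ mY).
Qed.

End Shelling.

Local Open Scope ring_scope.

Theorem theorem5p20 (n : nat) (E : {set edge n}) (le : rel (edge n)) :
  simple_graph E -> total_order_on E le -> strongly_upper_crossed E le ->
  [/\ (* (a) graded with rank function rk *)
      [/\ rk (set0 : {set edge n}) = 0%N,
          (forall X Y, covers E X Y -> rk Y = (rk X).+1) &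
          (forall X, isNC E X -> (forall Y, isNC E Y -> X \subset Y -> Y = X) ->
             rk X = rhoP E)],
      (* (b) EL-labeling, shellable *)
      EL_labeling E le /\ shellable (order_complex E),
      (* (c) *)
      (forall X s, isNC E X -> sat_chain E set0 X s ->
         decreasing le (labels le set0 s) ->
         spanning_ncnbc E le X (labelset (labels le set0 s))),
      (* (d) *)
      (forall X S, isNC E X -> spanning_ncnbc E le X S ->
         exists s, [/\ sat_chain E set0 X s, decreasing le (labels le set0 s),
           labelset (labels le set0 s) = S &
           forall s', sat_chain E set0 X s' -> decreasing le (labels le set0 s') ->
             labelset (labels le set0 s') = S -> s' = s]) &
      (* (e) *)
      (forall H, isNC E H -> mobius E H = (-1) ^+ rk H * (ncnbc E le (rk H) H)%:R)
      /\ (forall (R : fieldType) (t : R), t != 0 ->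
            chi_at E t = \sum_(k < #|E|.+1)
               (-1) ^+ k * (ncnbc E le k E)%:R * t ^ ((rhoP E)%:Z - k%:Z))].
Proof.
move=> sE tE suc; have ncE := NC_E sE suc.
split.
- split; first exact: rk0.
    exact: covers_rk sE tE suc.
  move=> X ncX maxX; rewrite (rhoP_E sE suc).
  by rewrite (maxX E ncE (NC_sub ncX)).
- by split; [exact: (min_labeling_EL sE tE suc) | exact: (NC_shellable sE tE suc)].
- move=> X s ncX /andP[ps /eqP <-] decs.
  by have [] := decreasing_chain sE tE suc ps decs.
- move=> X S ncX spS.
  have [s [cs decs lS]] := decreasing_chain_exists sE tE suc ncX spS.
  exists s; split=> // s' /andP[ps' _] decs' lS'; case/andP: cs => ps _.
  by apply: (decreasing_chain_unique sE tE suc ps' ps decs' decs); rewrite lS' lS.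
- by split=> [H ncH|R t _]; [exact: (mobiusE sE tE suc) | exact: (chi_atE sE tE suc)].
Qed.
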